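(* An orientation of the four-cycle $C_4$ is Eulerian-avoidable if and only if it is not isomorphic to $\vec K_{2,2}$.
   Context: All digraphs are finite and loopless, with no parallel arcs; digons (pairs of oppositely directed arcs between two vertices) are allowed. A digraph is Eulerian if every vertex has equal in-degree and out-degree (no connectivity is required). A digraph is $F$-free if it has no (not necessarily induced) subdigraph isomorphic to $F$. A digraph $F$ is Eulerian-avoidable if, for every positive integer $k$, there exists an integer $d$ such that every (nonempty) Eulerian digraph of minimum out-degree at least $d$ contains a (nonempty) $F$-free subdigraph (not required to be Eulerian) of minimum out-degree at least $k$. Up to isomorphism there are four orientations of the undirected 4-cycle $C_4$; on the vertex set $\{a,b,c,d\}$ their arc sets are: $A(\vec C_4)=\{a\to b,\ b\to c,\ c\to d,\ d\to a\}$; $A(C_4^{(1,3)})=\{a\to b,\ b\to c,\ c\to d,\ a\to d\}$; $A(C_4^{(2,2)})=\{a\to b,\ a\to d,\ b\to c,\ d\to c\}$; $A(\vec K_{2,2})=\{a\to b,\ a\to d,\ c\to b,\ c\to d\}$. *)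

(* Defs.v *)
From mathcomp Require Import all_boot.
Set Implicit Arguments.
Unset Strict Implicit.
Unset Printing Implicit Defensive.

(* Arcs form a relation, so there are no parallel arcs; digons are allowed. *)
Record digraph := Digraph {
  vertex :> finType;
  adj : rel vertex;
  adj_irr : irreflexive adj }.

Definition nonempty (D : digraph) : Prop := 0 < #|D|.

Definition outdeg (D : digraph) (v : D) : nat := #|[set w | adj v w]|.
Definition indeg (D : digraph) (v : D) : nat := #|[set u | adj u v]|.

Definition eulerian (D : digraph) : Prop := forall v : D, indeg v = outdeg v.

Definition min_outdeg_ge (D : digraph) (k : nat) : Prop :=
  forall v : D, k <= outdeg v.

Definition digraph_iso (D E : digraph) : Prop :=
  exists f : D -> E, bijective f /\ forall x y, adj (f x) (f y) = adj x y.

Record subdigraph (D : digraph) := Subdigraph {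
  sub_verts : {set D};
  sub_arc : rel D;
  sub_arcP : forall x y, sub_arc x y ->
    [/\ x \in sub_verts, y \in sub_verts & adj x y] }.

Section SubdigraphAsDigraph.
Variables (D : digraph) (H : subdigraph D).

Definition sub_digraph_arc : rel {x : D | x \in sub_verts H} :=
  fun u v => sub_arc H (val u) (val v).

Lemma sub_digraph_arc_irr : irreflexive sub_digraph_arc.
Proof.
by move=> u; apply/negP => /sub_arcP [_ _]; rewrite adj_irr.
Qed.

Definition digraph_of_sub : digraph := Digraph sub_digraph_arc_irr.

End SubdigraphAsDigraph.

Coercion digraph_of_sub : subdigraph >-> digraph.

Definition subdigraph_free (F D : digraph) : Prop :=
  ~ exists H : subdigraph D, digraph_iso F H.

Definition eulerian_avoidable (F : digraph) : Prop :=
  forall k : nat, 0 < k ->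
  exists d : nat, forall D : digraph,
    nonempty D -> eulerian D -> min_outdeg_ge D d ->
    exists H : subdigraph D,
      [/\ nonempty H, subdigraph_free F H & min_outdeg_ge H k].

(* F is, up to renaming its vertices along f, obtained from the undirected
   graph with edge relation e by giving each edge exactly one direction. *)
Definition orientation_of (T : finType) (e : rel T) (F : digraph) : Prop :=
  exists f : T -> F, [/\ bijective f,
    forall x y, e x y = adj (f x) (f y) || adj (f y) (f x) &
    forall x y, ~~ (adj (f x) (f y) && adj (f y) (f x))].

Definition C4 : rel 'I_4 :=
  fun i j => (j == i.+1 %% 4 :> nat) || (i == j.+1 %% 4 :> nat).

(* The vertices a, b, c, d are 0, 1, 2, 3. *)
Definition K22_arc : rel 'I_4 :=
  fun i j => (val i, val j) \in [:: (0, 1); (0, 3); (2, 1); (2, 3)].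

Lemma K22_arc_irr : irreflexive K22_arc.
Proof. by case=> [[|[|[|[|]]]]]. Qed.

Definition K22 : digraph := Digraph K22_arc_irr.

(* Main.v *)
Require Import Defs.
From mathcomp Require Import all_boot all_order all_algebra.
From mathcomp Require Import ring lra.

(** The alternating orientation K22 cannot be avoided because of the Eulerian
    digraphs [cyclic_tree n m]. Their vertices are the leaves and the inner
    nodes of a tree with high branching. A leaf points to all the nodes above
    it, and a node points to all the leaves below its cyclic successor among its
    siblings. Consider a subdigraph with out-degrees at least 3. If it contains
    all the children of a node that lie above one of its leaves, then the cyclic
    order puts leaves below all the children; these are so many that two leaves
    would use the same two nodes further up, unless below some child the leaves
    use at most one of them. Walking down the tree, one finds a leaf with at
    most two out-neighbours ([exists_few_used_or_K22]).

    The other three orientations are avoided by choosing few out-neighbours at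
    each vertex. If a vertex [v] of out-degree [d(v)] chooses at random, a given
    arc from [v] survives with probability about [1 / d(v)]. In an Eulerian
    digraph these numbers sum to 1 over the arcs out of a vertex, and the
    numbers [1 / d(v)] of the arcs [u -> v] also sum to 1 over [u]. For the
    directed cycle and for two parallel paths of length two, these sums show
    that the bad events which involve any given vertex have small total
    probability, and a weighted local lemma ([local_lemma], [sparse_sampling])
    yields a choice that avoids them all.

    For the remaining orientation [a -> b -> c -> d], [a -> d] the sum over [a]
    is bounded only when the degree of [b] is at most about the square of that
    of [a]. So each vertex keeps either only the arcs of this kind, or only the
    other ones, the jumps. The local lemma removes the patterns in which [a] has
    kept no jumps. If [a] has kept its jumps, it can afford to choose after the
    others, in decreasing order of degree, since each of its candidates [b] then
    excludes a bounded number of candidates [d]. The one case in which the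
    choice of [c] is not known in time is treated by making the lists of such
    vertices [a] and [c] meet in at most one element
    ([exists_almost_disjoint_subsets]), which is possible because the digraph of
    the pairs [(a, c)] has bounded out-degree and is therefore degenerate. *)

Import Order.TTheory GRing.Theory Num.Theory.
Set Implicit Arguments. Unset Strict Implicit. Unset Printing Implicit Defensive.

(** * Selections in digraphs of bounded out-degree *)

Lemma card_bigcup_leq (I T : finType) (P : pred I) (B : I -> {set T}) :
  #|\bigcup_(i | P i) B i| <= \sum_(i | P i) #|B i|.
Proof.
elim/big_rec2: _ => [|i n S _ IH]; first by rewrite cards0.
by apply: leq_trans (leq_card_setU _ _).1 _; rewrite leq_add2l.
Qed.

(** Inside any set of vertices the average in-degree equals the average
    out-degree. This is what replaces a bound on in-degrees, which are
    uncontrolled here. *)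
Lemma exists_small_total_degree (T : finType) (r : rel T) (q : nat) (U : {set T}) :
    U != set0 -> {in U, forall x, #|[set y in U | r x y]| <= q} ->
  exists2 x, x \in U & #|[set y in U | r x y || r y x]| <= 2 * q.
Proof.
move=> U0 rq; apply/exists_inP; apply: contraNT U0; rewrite negb_exists_in => /forall_inP big.
have sum1 (p : rel T) : \sum_(x in U) #|[set y in U | p x y]| =
    \sum_(x in U) \sum_(y in U) p x y.
  apply: eq_bigr => x _; rewrite -sum1_card big_mkcond [RHS]big_mkcond /=.
  by apply: eq_bigr => y _; rewrite !inE; case: (y \in U); case: (p x y).
have le : \sum_(x in U) (2 * q).+1 <= \sum_(x in U) (2 * q).
  apply: leq_trans (_ : \sum_(x in U) #|[set y in U | r x y || r y x]| <= _).
    by apply: leq_sum => x xU; rewrite ltnNge big.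
  rewrite sum1; apply: leq_trans (_ : \sum_(x in U) \sum_(y in U) (r x y + r y x) <= _).
    by apply: leq_sum => x _; apply: leq_sum => y _; case: (r x y); case: (r y x).
  under eq_bigr do rewrite big_split /=.
  rewrite big_split /= [X in _ + X]exchange_big /= -sum1 addnn -mul2n -big_distrr /=.
  by rewrite leq_mul2l /= leq_sum.
by move: le; rewrite !sum_nat_const leq_mul2l ltnn orbF cards_eq0.
Qed.

(** Greedy choice: a vertex of total degree at most [2 * q] rules out at most
    [(2 * q).+1] vertices, itself included. *)
Lemma exists_independent_subset (T : finType) (r : rel T) (q k : nat) (U : {set T}) :
    {in U, forall x, #|[set y in U | r x y]| <= q} -> k * (2 * q).+1 <= #|U| ->
  exists S : {set T}, [/\ S \subset U, #|S| = k &
    {in S &, forall x y, x != y -> ~~ r x y}].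
Proof.
elim: k U => [|k IH] U rq leU.
  by exists set0; rewrite sub0set cards0; split=> // x y; rewrite inE.
have U0 : U != set0 by rewrite -card_gt0; apply: leq_trans leU; rewrite mulSn.
have [x xU xq] := exists_small_total_degree U0 rq.
pose R := x |: [set y in U | r x y || r y x].
have Rq : #|R| <= (2 * q).+1.
  by rewrite /R cardsU1; case: (x \notin _) => //=; rewrite ?add1n ?add0n ?ltnS // leqW.
have [||S [SU Sk Sr]] := IH (U :\: R).
- move=> y /setDP[yU _]; apply: leq_trans (rq y yU); apply/subset_leq_card/subsetP => z.
  by rewrite !inE => /andP[/andP[_ ->] ->].
- rewrite cardsD; have : #|U :&: R| <= (2 * q).+1.
    by apply: leq_trans Rq; rewrite subset_leq_card ?subsetIr.
  by move: leU; rewrite mulSn => leU leR; rewrite leq_subRL;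
    [apply: leq_trans leU; rewrite leq_add2r | rewrite subset_leq_card ?subsetIl].
have xS : x \notin S by apply/negP => /(subsetP SU); rewrite !inE eqxx.
exists (x |: S); split.
- by rewrite subUset sub1set xU; apply: subset_trans SU _; apply: subsetDl.
- by rewrite cardsU1 xS Sk.
have Sx y : y \in S -> ~~ (r x y || r y x).
  move=> /(subsetP SU); rewrite !inE negb_or => /andP[/andP[_]].
  by rewrite negb_and => /orP[/negPf->|].
move=> y z; rewrite !inE => /predU1P[->|yS] /predU1P[->|zS] yz.
- by rewrite eqxx in yz.
- by have := Sx z zS; rewrite negb_or => /andP[].
- by have := Sx y yS; rewrite negb_or => /andP[].
- exact: Sr.
Qed.

(** Each [a] has to shrink its list [N a] to [y] elements so that the new lists
    meet in at most one element along every arc of [r]. Vertices are removed by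
    [exists_small_total_degree] and treated in the reverse order, so that a
    vertex meets at most [2 * q] lists that are already chosen. At most [h]
    elements of [N a] occur in [mu] of these lists or more; among the others,
    two elements clash when a chosen list contains both, and a set without
    clashes is what is needed. The number [mu * h] only has to exceed the total
    size of the lists. *)
Lemma exists_almost_disjoint_subsets (T T' : finType) (G : {set T}) (N : T -> {set T'})
    (r : rel T) (q y mu h : nat) :
    0 < mu -> 2 * q * y <= mu * h ->
    {in G, forall a, #|[set c in G | r a c]| <= q} ->
    {in G, forall a, h + y * (2 * (mu * y)).+1 <= #|N a|} ->
  exists Y : T -> {set T'},
    {in G, forall a, Y a \subset N a /\ #|Y a| = y} /\
    {in G &, forall a c, a != c -> r a c -> #|Y a :&: Y c| <= 1}.
Proof.
move=> mu0 qh rq Ny; suff: forall U : {set T}, U \subset G -> exists Y : T -> {set T'},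
    {in U, forall a, Y a \subset N a /\ #|Y a| = y} /\
    {in U &, forall a c, a != c -> r a c -> #|Y a :&: Y c| <= 1}.
  by apply.
move=> U; have [n] := ubnP #|U|; elim: n U => // n IH U ltUn UG.
have [->|U0] := eqVneq U set0.
  by exists (fun=> set0); split=> a; rewrite inE.
have [a aU aq] : exists2 a, a \in U & #|[set c in U | r a c || r c a]| <= 2 * q.
  apply: exists_small_total_degree => // a aU; apply: leq_trans (rq a (subsetP UG a aU)).
  by apply/subset_leq_card/subsetP => c; rewrite !inE => /andP[/(subsetP UG)-> ->].
have ltU : #|U :\ a| < n by rewrite -ltnS; move: ltUn; rewrite (cardsD1 a U) aU.
have [Y [YN Yr]] := IH _ ltU (subset_trans (subsetDl _ _) UG).
pose R := [set c in U | r a c || r c a] :\ a.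
have Rq : #|R| <= 2 * q by apply: leq_trans aq; rewrite subset_leq_card ?subsetDl.
have YR c : c \in R -> #|Y c| = y.
  by rewrite !inE => /and3P[ca cU _]; apply: (YN c _).2; rewrite !inE ca.
pose mult s := #|[set c in R | s \in Y c]|.
pose heavy := [set s in N a | mu <= mult s].
have heavy_h : #|heavy| <= h.
  rewrite -(leq_pmul2l mu0); apply: leq_trans qh.
  apply: leq_trans (_ : \sum_(c in R) #|Y c| <= _); last first.
    by rewrite (eq_bigr (fun=> y)) // sum_nat_const leq_mul2r Rq orbT.
  have -> : \sum_(c in R) #|Y c| = \sum_s mult s.
    rewrite (eq_bigr (fun c => \sum_s (s \in Y c))); last first.
      by move=> c _; rewrite -sum1_card big_mkcond.
    rewrite exchange_big; apply: eq_bigr => s _; rewrite /mult -sum1_card.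
    rewrite big_mkcond [RHS]big_mkcond; apply: eq_bigr => c _ /=.
    by rewrite inE; case: (c \in R); case: (s \in Y c).
  rewrite mulnC -sum_nat_const [leqRHS](bigID (mem heavy)) /=.
  apply: leq_trans (leq_addr _ _); apply: leq_sum => s.
  by rewrite inE => /andP[].
pose clash s t := [exists c in R, (s \in Y c) && (t \in Y c)].
have [||S [SN Sy Sc]] := @exists_independent_subset _ clash (mu * y) y (N a :\: heavy).
- move=> s /setDP[sN]; rewrite inE sN /= -ltnNge => /ltnW lt_mu.
  apply: leq_trans (_ : #|\bigcup_(c in [set c in R | s \in Y c]) Y c| <= _).
    apply/subset_leq_card/subsetP => t; rewrite inE => /andP[_ /existsP[c /and3P[cR sc tc]]].
    by apply/bigcupP; exists c => //; rewrite inE cR.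
  apply: leq_trans (_ : \sum_(c in [set c in R | s \in Y c]) #|Y c| <= _);
    first exact: card_bigcup_leq.
  rewrite (eq_bigr (fun=> y)); first by rewrite sum_nat_const leq_mul2r lt_mu orbT.
  by move=> c; rewrite inE => /andP[/YR].
- rewrite cardsD leq_subRL; last by rewrite subset_leq_card ?subsetIl.
  apply: leq_trans (Ny a (subsetP UG a aU)); rewrite leq_add2r.
  by apply: leq_trans heavy_h; rewrite subset_leq_card ?subsetIr.
have SY c : c \in R -> #|S :&: Y c| <= 1.
  move=> cR; apply/card_le1_eqP => s t; rewrite !inE => /andP[sS sY] /andP[tS tY].
  apply/eqP/negPn/negP => st; have /negP[] := Sc _ _ tS sS st.
  by apply/exists_inP; exists c; rewrite ?sY ?tY.
exists (fun c => if c == a then S else Y c); split.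
  move=> c cU; case: eqP => [->|/eqP ca]; last by apply: YN; rewrite !inE ca.
  by split=> //; apply: subset_trans SN _; apply: subsetDl.
move=> b c bU cU; case: (eqVneq b a) => [->|ba]; case: (eqVneq c a) => [->|ca] bc rbc.
- by move: bc; rewrite ?eqxx.
- by apply: SY; rewrite !inE ca cU rbc.
- by rewrite setIC; apply: SY; rewrite !inE ba bU rbc orbT.
- by apply: Yr; rewrite ?inE ?ba ?ca.
Qed.

(** * A local lemma for forbidden partial assignments *)

Section LocalLemma.
Variables (X Y I : finType) (A : X -> {set Y}) (P : pred I).
Variable ev : I -> seq (X * Y).
Implicit Types (f g : {ffun X -> Y}) (s : seq (X * Y)) (Z : {set X}).

Definition hit f s := all (fun p => f p.1 == p.2) s.

(** Only the events all of whose variables lie in [Z] are excluded, although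
    every variable is assigned: comparing two sets [Z] is then comparing two
    subsets of the same finite type, and enlarging [Z] by one variable is the
    analogue of assigning one more variable. *)
Definition avoiding Z : {set {ffun X -> Y}} :=
  [set f : {ffun X -> Y} | [forall x, f x \in A x] &&
    [forall e, P e && all (mem Z) (unzip1 (ev e)) ==> ~~ hit f (ev e)]].

Definition update f x y : {ffun X -> Y} := [ffun t => if t == x then y else f t].

Lemma eq_hit f g s : {in unzip1 s, f =1 g} -> hit f s = hit g s.
Proof.
by move=> fg; apply: eq_in_all => p ps; rewrite fg //; apply: map_f.
Qed.

Lemma update_avoiding Z f x y :
  x \notin Z -> y \in A x -> f \in avoiding Z -> update f x y \in avoiding Z.
Proof.
move=> xZ yA; rewrite !inE => /andP[/forallP fA /forallP fP].
apply/andP; split; apply/forallP.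
  by move=> t; rewrite ffunE; case: eqP => [->|].
move=> e; apply/implyP => /andP[Pe eZ].
have := fP e; rewrite Pe eZ /=; congr (~~ _); apply: eq_hit => t te.
by rewrite ffunE; case: eqP => // tx; have := allP eZ _ te; rewrite /= tx (negPf xZ).
Qed.

(** Independence: the assignments in [avoiding Z] can be modified freely on the
    variables outside [Z], so that each prescribed value outside [Z] costs a
    factor [#|A x|]. *)
Lemma card_hit Z s :
    uniq (unzip1 s) -> {in unzip1 s, forall x, x \notin Z} ->
  #|[set f in avoiding Z | hit f s]| * \prod_(p <- s) #|A p.1| <= #|avoiding Z|.
Proof.
elim: s => [|[x y] s IH] /=.
  by move=> _ _; rewrite big_nil muln1 subset_leq_card //;
     apply/subsetP=> f; rewrite inE => /andP[].
move=> /andP[xs us] sZ; rewrite big_cons mulnA /=.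
have xZ : x \notin Z by apply: sZ; rewrite inE eqxx.
apply: leq_trans (IH us _); last by move=> t ts; apply: sZ; rewrite inE ts orbT.
rewrite leq_mul2r; apply/orP; right; rewrite -cardsX.
pose g (q : {ffun X -> Y} * Y) := update q.1 x q.2.
rewrite -(card_in_imset (f := g)); last first.
  move=> [f1 y1] [f2 y2]; rewrite !inE /= => /andP[/and3P[_ /eqP f1y _] _].
  move=> /andP[/and3P[_ /eqP f2y _] _] /ffunP gg.
  congr (_, _); last by have := gg x; rewrite !ffunE eqxx.
  by apply/ffunP => t; have := gg t; rewrite !ffunE; case: eqP => [->|//]; rewrite f1y f2y.
apply/subset_leq_card/subsetP => _ /imsetP[[f z] fz ->].
have /setXP[/setIdP[fZ fh] zA] := fz; rewrite /= in fZ fh zA.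
apply/setIdP; split; first exact: update_avoiding.
have /andP[_ fs] := fh; rewrite -(eq_hit (f := f)) // => t ts.
by rewrite ffunE; case: eqP => // tx; rewrite -tx ts in xs.
Qed.

Local Open Scope ring_scope.

Hypothesis ev_uniq : forall e, P e -> uniq (unzip1 (ev e)).
Hypothesis ev_nil : forall e, P e -> ev e != [::].
Hypothesis A_gt0 : forall x, (0 < #|A x|)%N.
(** The weight of a constraint on [x] is twice its probability; the factor 2
    pays for the loss of one half per variable in the next lemma. *)
Hypothesis ev_small : forall x,
  \sum_(e | P e && (x \in unzip1 (ev e))) \prod_(p <- ev e) (2 / #|A p.1|%:R) <= 1 :> rat.

(** Counting form of the local lemma: each new variable at worst halves the
    number of good assignments. An assignment that is lost by adding [x] to [Z]
    hits an event [e] through [x]; outside the variables of [e] it still avoids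
    what it has to avoid, and by induction passing from [Z] minus these
    variables to [Z] costs a factor at most 2 for each of them except [x]. With
    independence, the event [e] destroys at most half its weight of [avoiding
    Z], and the weights of the events through [x] sum to at most 1. *)
Lemma avoiding_setU1 Z x :
  x \notin Z -> #|avoiding Z|%:R <= 2 * #|avoiding (x |: Z)|%:R :> rat.
Proof.
have [n] := ubnP #|Z|; elim: n Z x => // n IH Z x ltZn xZ.
have sub Z' k : Z' \subset Z -> (#|Z| - #|Z'| <= k)%N ->
    #|avoiding Z'|%:R <= 2 ^+ k * #|avoiding Z|%:R :> rat.
  elim: k Z' => [|k IHk] Z' sZ le_k.
    have /eqP -> : Z' == Z by rewrite eqEcard sZ -subn_eq0 -leqn0.
    by rewrite mul1r.
  have [eqZ|neqZ] := eqVneq Z' Z.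
    by rewrite eqZ ler_peMl // ?ler0n // exprn_ege1 // ler1n.
  have /properP[_ [t tZ tZ']] : Z' \proper Z by rewrite properEneq neqZ.
  have ltZ' : (#|Z'| < #|Z|)%N by rewrite proper_card // properEneq neqZ.
  apply: le_trans (IH Z' t (leq_trans ltZ' _) tZ') _; first by rewrite -ltnS.
  rewrite exprS -mulrA ler_pM2l ?ltr0n //; apply: IHk.
    by rewrite subUset sub1set tZ.
  by rewrite cardsU1 tZ' add1n subnS -subn1 leq_subLR add1n.
pose bad e := [set f in avoiding (Z :\: [set t in unzip1 (ev e)]) | hit f (ev e)].
(* [bad e] forgets the constraints that share a variable with [e], which makes
   it independent of hitting [e]. *)
have cover : avoiding Z \subset avoiding (x |: Z) :|:
    \bigcup_(e | P e && (x \in unzip1 (ev e))) bad e.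
  apply/subsetP => f fZ; rewrite inE; have [//|fxZ /=] := boolP (f \in avoiding (x |: Z)).
  move: (fZ) fxZ; rewrite !inE => /andP[fA fP]; rewrite fA /= negb_forall.
  move=> /existsP[e]; rewrite negb_imply negbK => /andP[/andP[Pe exZ] fe].
  apply/bigcupP; exists e.
    rewrite Pe /=; apply: contraLR (fe) => xe; have := forallP fP e; rewrite Pe /=.
    suff -> : all (mem Z) (unzip1 (ev e)) by [].
    apply/allP => t te; have := allP exZ t te; rewrite !inE => /orP[/eqP tx|//].
    by rewrite tx (negPf xe) in te.
  rewrite !inE fe andbT fA /=; apply/forallP => e'; apply/implyP => /andP[Pe' e'Z].
  have := forallP fP e'; rewrite Pe' /=; suff -> : all (mem Z) (unzip1 (ev e')) by [].
  by apply/allP => t te; have := allP e'Z t te; rewrite !inE => /andP[].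
have bad_small e : P e && (x \in unzip1 (ev e)) ->
    #|bad e|%:R <= #|avoiding Z|%:R / 2 * \prod_(p <- ev e) (2 / #|A p.1|%:R) :> rat.
  move=> /andP[Pe xe].
  have Zlt : (#|Z| - #|Z :\: [set t in unzip1 (ev e)]| <= (size (ev e)).-1)%N.
    rewrite cardsD subKn ?subset_leq_card ?subsetIl //.
    have -> : (size (ev e)).-1 = #|[set t in unzip1 (ev e)] :\ x|.
      have /card_uniqP ce := ev_uniq Pe.
      have := cardsD1 x [set t in unzip1 (ev e)].
      by rewrite inE xe cardsE ce size_map add1n => ->.
    apply/subset_leq_card/subsetP => t; rewrite !inE => /andP[tZ ->]; rewrite andbT.
    by apply: contraNneq xZ => <-.
  have := card_hit (Z := Z :\: [set t in unzip1 (ev e)]) (ev_uniq Pe).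
  have nZ : {in unzip1 (ev e), forall t, t \notin Z :\: [set t in unzip1 (ev e)]}.
    by move=> t te; rewrite !inE te.
  move=> /(_ nZ); rewrite -/(bad e) -(ler_nat rat) natrM => le1.
  have le2 := le_trans le1 (sub _ _ (subsetDl _ _) Zlt).
  have prod_gt0 : 0 < \prod_(p <- ev e) #|A p.1|%:R :> rat.
    by apply: prodr_gt0 => p _; rewrite ltr0n.
  rewrite natr_prod -ler_pdivlMr // in le2.
  apply: le_trans le2 _; rewrite big_split /= prodfV big_const_seq count_predT.
  rewrite -Monoid.iteropE -[iterop _ _ _ _]/(2 ^+ _).
  rewrite mulrA ler_pM2r ?invr_gt0 // -mulrA mulrC.
  have -> : size (ev e) = (size (ev e)).-1.+1.
    by case: (ev e) (ev_nil Pe).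
  by rewrite exprS mulKf.
have : #|avoiding Z|%:R <= #|avoiding (x |: Z)|%:R + #|avoiding Z|%:R / 2 :> rat.
  have : (#|avoiding Z| <= #|avoiding (x |: Z)| +
      \sum_(e | P e && (x \in unzip1 (ev e))) #|bad e|)%N.
    apply: leq_trans (subset_leq_card cover) _.
    apply: leq_trans (leq_card_setU _ _).1 _; rewrite leq_add2l.
    exact: card_bigcup_leq.
  rewrite -(ler_nat rat) => /le_trans; apply.
  rewrite natrD lerD2l natr_sum; apply: le_trans (ler_sum _ bad_small) _.
  by rewrite -mulr_sumr ler_piMr // divr_ge0 // ler0n.
set a := (#|avoiding Z|%:R : rat); set b := (#|_|%:R : rat).
rewrite -lerBlDr => leab; apply: le_trans (_ : 2 * (a - a / 2) <= _).
  by rewrite mulrBr [2 * (a / 2)]mulrC divfK // mulr_natl mulr2n addrK.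
by rewrite ler_pM2l.
Qed.

Lemma local_lemma : exists f : {ffun X -> Y},
  (forall x, f x \in A x) /\ (forall e, P e -> ~~ hit f (ev e)).
Proof.
have av0 : (0 < #|avoiding set0|)%N.
  have /fin_all_exists[g gA] : forall x, exists y, y \in A x.
    by move=> x; apply/set0Pn; rewrite -card_gt0.
  apply/card_gt0P; exists [ffun x => g x]; rewrite inE; apply/andP; split.
    by apply/forallP => x; rewrite ffunE.
  apply/forallP => e; apply/implyP => /andP[Pe]; have := ev_nil Pe.
  by case: (ev e) => // p s _ /=; rewrite inE.
have av Z : (0 < #|avoiding Z|)%N.
  have [n] := ubnP #|Z|; elim: n Z => // n IH Z ltZn.
  have [->//|/set0Pn[x xZ]] := eqVneq Z set0.
  have := IH (Z :\ x); rewrite (cardsD1 x Z) xZ /= in ltZn *.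
  move=> /(_ ltZn) gt0; have /avoiding_setU1 : x \notin Z :\ x by rewrite !inE eqxx.
  rewrite setD1K // => le; have : 0 < #|avoiding (Z :\ x)|%:R :> rat by rewrite ltr0n.
  by move=> /lt_le_trans /(_ le); rewrite pmulr_rgt0 // ltr0n.
have /card_gt0P[f] := av setT; rewrite inE => /andP[/forallP fA /forallP fP].
exists f; split=> // e Pe; have := fP e; rewrite Pe /=.
by suff -> : all (mem [set: X]) (unzip1 (ev e)) by []; apply/allP => t _; rewrite inE.
Qed.

End LocalLemma.

(** * Random out-neighbours that avoid rare patterns of four arcs *)

(** Each vertex [v] chooses [M] out-neighbours in [A v] by filling [M] slots
    independently. The events to avoid are the patterns [arcs e], once for each
    assignment of slots to their arcs, and the collisions between two slots of
    the same vertex. The lists [A v] have no common size and nothing bounds the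
    number of lists that contain a given vertex, so the local lemma is needed in
    its weighted form. *)
Section SparseSampling.
Variables (V I : finType) (A : V -> {set V}) (P : pred I).
Variables (arcs : I -> 4.-tuple (V * V)) (M : nat).
Hypothesis M_gt0 : 0 < M.
Hypothesis A_large : forall v, 16 * M <= #|A v|.
Hypothesis arcs_uniq : forall e, P e -> uniq (arcs e).

Let slot : Type := (V * 'I_M)%type.
Let event : Type := (I * 4.-tuple 'I_M + (V * V * 'I_M * 'I_M))%type.

Definition constraints (e : event) : seq (slot * V) :=
  match e with
  | inl (e, g) => [seq ((q.1.1, q.2), q.1.2) | q <- zip (arcs e) g]
  | inr (v, u, i, j) => [:: ((v, i), u); ((v, j), u)]
  end.

Definition relevant (e : event) : bool :=
  match e with
  | inl (e, _) as ev => P e && uniq (unzip1 (constraints ev))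
  | inr (v, u, i, j) => (i != j) && (u \in A v)
  end.

Local Open Scope ring_scope.

(** Four arcs carry [M ^ 4] assignments of slots and a factor [2 ^ 4] from the
    weights of the local lemma; half of the total weight 1 is left to
    collisions. *)
Hypothesis arcs_rare : forall v, 32 * M%:R ^+ 4 *
  \sum_(e | P e && (v \in unzip1 (arcs e))) \prod_(p <- arcs e) #|A p.1|%:R^-1 <= 1 :> rat.

Let A_gt0 v : (0 < #|A v|)%N.
Proof. by apply: leq_trans (A_large v); rewrite muln_gt0. Qed.

Lemma pattern_weight x :
  \sum_(q : I * 4.-tuple 'I_M | relevant (inl q) && (x \in unzip1 (constraints (inl q))))
     \prod_(p <- constraints (inl q)) (2 / #|A p.1.1|%:R) <= 2^-1 :> rat.
Proof.
have prodE (q : I * 4.-tuple 'I_M) : \prod_(p <- constraints (inl q)) (2 / #|A p.1.1|%:R) =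
    16 * \prod_(p <- arcs q.1) #|A p.1|%:R^-1 :> rat.
  case: q => e g; rewrite /= big_map.
  have -> : \prod_(p <- zip (arcs e) g) (2 / #|A p.1.1|%:R) =
      \prod_(p <- unzip1 (zip (arcs e) g)) (2 / #|A p.1|%:R) :> rat by rewrite big_map.
  rewrite unzip1_zip ?size_tuple // big_split /= big_const_seq count_predT.
  by rewrite -Monoid.iteropE -[iterop _ _ _ _]/(2 ^+ _) size_tuple -natrX.
rewrite (eq_bigr _ (fun q _ => prodE q)) -mulr_sumr.
apply: le_trans (_ : 16 * \sum_(q : I * 4.-tuple 'I_M | P q.1 && (x.1 \in unzip1 (arcs q.1)))
    \prod_(p <- arcs q.1) #|A p.1|%:R^-1 <= _).
  rewrite ler_pM2l // [leLHS]big_mkcond [leRHS]big_mkcond /=.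
  have ge0 (e : I) : 0 <= \prod_(p <- arcs e) #|A p.1|%:R^-1 :> rat.
    by apply: prodr_ge0 => p _; rewrite invr_ge0 ler0n.
  apply: ler_sum => -[e g] _ /=; case: ifP => [/andP[/andP[-> _]]|]; last by case: ifP.
  rewrite /unzip1 -map_comp => /mapP[[p i] /= pz ->] /=.
  rewrite (_ : p.1 \in _) //; apply: map_f.
  by have := map_f fst pz; rewrite -/(unzip1 _) unzip1_zip ?size_tuple.
have -> : \sum_(q : I * 4.-tuple 'I_M | P q.1 && (x.1 \in unzip1 (arcs q.1)))
    \prod_(p <- arcs q.1) #|A p.1|%:R^-1 =
  M%:R ^+ 4 * \sum_(e | P e && (x.1 \in unzip1 (arcs e)))
    \prod_(p <- arcs e) #|A p.1|%:R^-1 :> rat.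
  rewrite mulr_sumr.
  rewrite (eq_bigl (fun q : I * 4.-tuple 'I_M => (P q.1 && (x.1 \in unzip1 (arcs q.1))) && true));
    last by move=> q; rewrite andbT.
  rewrite -(pair_big_dep (fun e => P e && (x.1 \in unzip1 (arcs e))) (fun _ _ => true)
     (fun e _ => \prod_(p <- arcs e) #|A p.1|%:R^-1 : rat)) /=.
  apply: eq_bigr => e _; by rewrite sumr_const card_tuple card_ord -natrX mulr_natl.
have := arcs_rare x.1; set S := (X in _ * X <= 1); set m := _ ^+ 4.
by rewrite -[X in 16 * (m * X)]/S => ?; lra.
Qed.

Lemma collision_weight x :
  \sum_(q : V * V * 'I_M * 'I_M | relevant (inr q) && (x \in unzip1 (constraints (inr q))))
     \prod_(p <- constraints (inr q)) (2 / #|A p.1.1|%:R) <= 2^-1 :> rat.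
Proof.
case: x => v i; set n : rat := #|A v|%:R.
have n_gt0 : 0 < n by rewrite ltr0n.
pose S := (fun q : V * 'I_M => (v, q.1, i, q.2)) @: setX (A v) setT :|:
          (fun q : V * 'I_M => (v, q.1, q.2, i)) @: setX (A v) setT.
have cardS : (#|S| <= 2 * (#|A v| * M))%N.
  apply: leq_trans (leq_card_setU _ _).1 _; rewrite mul2n -addnn.
  by apply: leq_add; apply: leq_trans (leq_imset_card _ _) _; rewrite cardsX cardsT card_ord.
apply: le_trans (_ : \sum_(q in S) (2 / n) ^+ 2 <= _).
  rewrite [leLHS]big_mkcond [leRHS]big_mkcond; apply: ler_sum => -[[[w u] a] b] _.
  have ge0 : 0 <= (2 / n) ^+ 2 by rewrite sqr_ge0.
  case: ifP => [/andP[/andP[_ uA] iwab]|_]; last by case: ifP.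
  have /andP[/eqP vw iab] : (v == w) && ((i == a) || (i == b)).
    by move: iwab; rewrite !inE !xpair_eqE andb_orr.
  rewrite -vw in uA *; have -> : (v, u, a, b) \in S.
    case/orP: iab => /eqP <-; rewrite inE; apply/orP; [left|right]; apply/imsetP.
      by exists (u, b); rewrite ?inE ?uA.
    by exists (u, a); rewrite ?inE ?uA.
  by rewrite !big_cons big_nil mulr1 expr2.
rewrite sumr_const -[_ *+ #|S|]mulr_natl.
apply: le_trans (_ : (2 * (#|A v| * M))%:R * (2 / n) ^+ 2 <= _).
  by rewrite ler_wpM2r ?sqr_ge0 // ler_nat.
have -> : (2 * (#|A v| * M))%:R * (2 / n) ^+ 2 = (16 * M)%:R / n / 2 :> rat.
  rewrite !natrM -/n; field; exact: lt0r_neq0.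
rewrite ler_pdivrMr // mulVf // ler_pdivrMr // mul1r ler_nat.
exact: A_large.
Qed.

Lemma sparse_sampling : exists H : V -> {set V},
  (forall v, H v \subset A v /\ #|H v| = M) /\
  (forall e, P e -> ~~ all (fun p => p.2 \in H p.1) (arcs e)).
Proof.
have [|||x|f [fA fP]] := @local_lemma slot V event (fun x => A x.1) relevant constraints.
- by case=> [[e g] /andP[]|[[[v u] i] j] /= /andP[ij _]] //; rewrite inE xpair_eqE eqxx /= ij.
- by case=> [[e g]|[[[v u] i] j]] //= _; case: (arcs e) => -[|p s] //= _; case: g => -[].
- by move=> x; apply: A_gt0.
- rewrite big_sumType /= [leRHS](_ : 1 = 2^-1 + 2^-1) //.
  exact: lerD (pattern_weight x) (collision_weight x).
exists (fun v => [set f (v, i) | i : 'I_M]); split.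
  move=> v; split; first by apply/subsetP => _ /imsetP[i _ ->]; apply: fA.
  rewrite card_imset ?card_ord // => i j fij; apply/eqP; apply: contraT => ij.
  have := fP (inr (v, f (v, i), i, j)); rewrite /= ij fA => /(_ isT).
  by rewrite eqxx fij eqxx.
move=> e Pe; apply/negP => /allP all_e.
pose i0 := Ordinal M_gt0.
(* [idx p] is the slot in which the arc [p] was chosen. *)
pose idx (p : V * V) := odflt i0 [pick i | f (p.1, i) == p.2].
have fidx p : p \in val (arcs e) -> f (p.1, idx p) = p.2.
  move=> /all_e /imsetP[i _ pi]; rewrite /idx; case: pickP => [j /eqP //|/(_ i)].
  by rewrite pi eqxx.
have zipE : zip (arcs e) [tuple of map idx (arcs e)] = [seq (p, idx p) | p <- arcs e].
  by rewrite /= -{1}[val (arcs e)]map_id zip_map.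
have := fP (inl (e, [tuple of map idx (arcs e)])); rewrite /= zipE -!map_comp Pe /=.
have slots_uniq : uniq [seq (p.1, idx p) | p <- arcs e].
  rewrite map_inj_in_uniq ?arcs_uniq // => -[a b] [c d] pe qe /= [ac idxE].
  by have := fidx _ pe; rewrite /= idxE ac (fidx _ qe) /= => ->.
rewrite /unzip1 -map_comp => /(_ slots_uniq)/negP[].
by apply/allP => _ /mapP[p pe ->] /=; rewrite fidx.
Qed.

End SparseSampling.

(** * Sampling in Eulerian digraphs *)

(** Locked, since otherwise comparing two hypotheses by conversion would unfold
    the numeral. *)
Definition sampling_threshold (M : nat) : nat := locked (2048 * M ^ 4).

Section Estimates.
Local Open Scope ring_scope.

Lemma threshold_arith (R : realFieldType) (m c s w : R) :
  0 <= m -> 0 < c -> 2048 * m <= c -> s <= 16 * w -> w <= 4 * c^-1 ->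
  32 * m * s <= 1.
Proof.
move=> m0 c0 mc sw wc; apply: le_trans (_ : 32 * m * (16 * (4 * c^-1)) <= _).
  apply: ler_wpM2l; first by rewrite mulr_ge0.
  by apply: le_trans sw _; rewrite ler_wpM2l.
have -> : 32 * m * (16 * (4 * c^-1)) = 2048 * m / c by ring.
by rewrite ler_pdivrMr ?mul1r.
Qed.

Lemma ler_trade (R : realFieldType) (e a b c d : R) :
  0 <= a -> 0 <= b -> 0 <= c -> d <= e -> d * (a * (b * c)) <= e * (a * (b * c)).
Proof. by move=> *; rewrite ler_wpM2r // !mulr_ge0. Qed.

End Estimates.

Section EulerianSampling.
Local Open Scope ring_scope.
Variables (D : digraph) (M C : nat).
Hypothesis D_eulerian : eulerian D.
Hypothesis M_gt0 : (0 < M)%N.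
Hypothesis C_large : (sampling_threshold M <= C)%N.
Hypothesis D_large : min_outdeg_ge D C.

Local Notation quad := (D * D * D * D)%type.

Definition inv_deg (v : D) : rat := (outdeg v)%:R^-1.
(** The random walk on an Eulerian digraph has the degree as a stationary
    measure: the transition probabilities [out_step] sum to 1 over the heads
    and, weighted by the degrees at both ends, the reversed probabilities
    [in_step] sum to 1 over the tails. This is where being Eulerian enters. *)
Definition out_step (u v : D) : rat := (adj u v)%:R * inv_deg u.
Definition in_step (u v : D) : rat := (adj u v)%:R * inv_deg v.

Let C_gt0 : (0 < C)%N.
Proof.
by apply: leq_trans C_large; rewrite /sampling_threshold -lock muln_gt0 expn_gt0 M_gt0.
Qed.

Lemma outdeg_gt0 (v : D) : (0 < outdeg v)%N.
Proof. exact: leq_trans (D_large v). Qed.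

Lemma inv_deg_ge0 v : 0 <= inv_deg v.
Proof. by rewrite invr_ge0 ler0n. Qed.

Lemma inv_deg_le v : inv_deg v <= C%:R^-1.
Proof. by rewrite lef_pV2 ?posrE ?ltr0n ?outdeg_gt0 // ler_nat D_large. Qed.

Lemma out_step_ge0 u v : 0 <= out_step u v.
Proof. by rewrite mulr_ge0 ?ler0n ?inv_deg_ge0. Qed.

Lemma in_step_ge0 u v : 0 <= in_step u v.
Proof. by rewrite mulr_ge0 ?ler0n ?inv_deg_ge0. Qed.

Lemma sum_out_step u : \sum_v out_step u v <= 1.
Proof.
rewrite -mulr_suml -natr_sum -big_mkcond sum1dep_card /= mulfV //.
by rewrite pnatr_eq0 -lt0n outdeg_gt0.
Qed.

Lemma sum_in_step v : \sum_u in_step u v <= 1.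
Proof.
rewrite -mulr_suml -natr_sum -big_mkcond sum1dep_card /=.
have -> : #|[set u | adj u v]| = outdeg v by rewrite -D_eulerian.
by rewrite mulfV // pnatr_eq0 -lt0n outdeg_gt0.
Qed.

(** The patterns through a fixed vertex are enumerated along a walk of three
    steps [K1], [K2], [K3]; the map [io] inserts the fixed vertex into the
    triple of the other three. *)
Lemma sum_walk_le (F : quad -> rat) (X : pred quad) (io : D * D * D -> quad)
    (pi : quad -> D * D * D) (K1 : D -> rat) (K2 : D -> D -> rat)
    (K3 : D -> D -> D -> rat) (eps : rat) :
    (forall q, X q -> io (pi q) = q) -> (forall q, 0 <= F q) -> 0 <= eps ->
    (forall x, 0 <= K1 x) -> (forall x y, 0 <= K2 x y) ->
    \sum_x K1 x <= 1 -> (forall x, \sum_y K2 x y <= 1) ->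
    (forall x y, \sum_z K3 x y z <= 1) ->
    (forall x y z, F (io (x, y, z)) <= eps * (K1 x * (K2 x y * K3 x y z))) ->
  \sum_(q | X q) F q <= eps.
Proof.
move=> ioK F0 eps0 K10 K20 K1s K2s K3s FK.
rewrite (reindex_onto io pi ioK) /=.
apply: le_trans (_ : \sum_t F (io t) <= _).
  by rewrite [leLHS]big_mkcond; apply: ler_sum => t _; case: ifP.
have -> : \sum_t F (io t) = \sum_x \sum_y \sum_z F (io (x, y, z)).
  by rewrite !pair_bigA /=; apply: eq_bigr => -[[x y] z].
apply: le_trans (_ : \sum_x \sum_y \sum_z eps * (K1 x * (K2 x y * K3 x y z)) <= _).
  by do 3![apply: ler_sum => ? _].
rewrite -[leRHS]mulr1; under eq_bigr do under eq_bigr do rewrite -mulr_sumr.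
under eq_bigr do rewrite -mulr_sumr.
rewrite -mulr_sumr ler_wpM2l //; apply: le_trans K1s; apply: ler_sum => x _.
under eq_bigr do rewrite -mulr_sumr.
rewrite -mulr_sumr ler_piMr //; apply: le_trans (K2s x); apply: ler_sum => y _.
by rewrite -mulr_sumr ler_piMr.
Qed.

Section Pattern.
Variables (A : D -> {set D}) (P : pred quad) (arcs : quad -> 4.-tuple (D * D)).
Hypothesis A_half : forall v, (outdeg v <= 2 * #|A v|)%N.
Hypothesis arcs_uniq : forall q, P q -> uniq (arcs q).
Hypothesis role_rare : forall v (r : 'I_4),
  \sum_(q | P q && ((tnth (arcs q) r).1 == v)) \prod_(p <- arcs q) inv_deg p.1 <= C%:R^-1.

(** The sum over the events at [v] is split by the arc of the pattern whose tail
    is [v]. The number 2048 is [32 * 2 ^ 4 * 4], where [2 ^ 4] comes from the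
    factor 2 in [A_half] and 4 is the number of arcs. *)
Lemma sampling : exists H : D -> {set D},
  (forall v, H v \subset A v /\ #|H v| = M) /\
  (forall q, P q -> ~~ all (fun p => p.2 \in H p.1) (arcs q)).
Proof.
have A_gt0 v : (0 < #|A v|)%N.
  by rewrite -(ltn_pmul2l (m := 2)) // muln0; apply: leq_trans (A_half v); apply: outdeg_gt0.
apply: (sparse_sampling M_gt0 _ arcs_uniq) => v.
  rewrite -(leq_pmul2l (m := 2)) // mulnA; apply: leq_trans (A_half v).
  apply: leq_trans (D_large v); apply: leq_trans C_large.
  rewrite /sampling_threshold -lock; apply: leq_mul => //.
  by rewrite -{1}[M]expn1 leq_pexp2l.
have weight_le q : \prod_(p <- arcs q) #|A p.1|%:R^-1 <= 16 * \prod_(p <- arcs q) inv_deg p.1.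
  have -> : 16 = 2 ^+ size (arcs q) :> rat by rewrite size_tuple -natrX.
  have -> : 2 ^+ size (arcs q) = \prod_(p <- arcs q) 2 :> rat.
    by rewrite big_const_seq count_predT -Monoid.iteropE.
  rewrite -big_split /=; apply: ler_prod => p _; rewrite invr_ge0 ler0n /=.
  rewrite -[leLHS]mul1r ler_pdivrMr ?ltr0n // mulrAC ler_pdivlMr ?ltr0n ?outdeg_gt0 //.
  by rewrite mul1r -natrM ler_nat.
have prod_ge0 q : 0 <= \prod_(p <- arcs q) inv_deg p.1.
  by apply: prodr_ge0 => p _; apply: inv_deg_ge0.
apply: (@threshold_arith _ _ C%:R _
    (\sum_(q | P q && (v \in unzip1 (arcs q))) \prod_(p <- arcs q) inv_deg p.1)).
- by rewrite exprn_ge0 ?ler0n.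
- by rewrite ltr0n.
- by rewrite -natrX -natrM ler_nat; move: C_large; rewrite /sampling_threshold -lock.
- rewrite mulr_sumr; exact: ler_sum.
apply: le_trans (_ : \sum_(r < 4) \sum_(q | P q && ((tnth (arcs q) r).1 == v))
   \prod_(p <- arcs q) inv_deg p.1 <= _).
  rewrite (exchange_big_dep P) /=; last by move=> r q _ /andP[].
  rewrite [leLHS]big_mkcondr; apply: ler_sum => q Pq; case: ifP => [|_]; last exact: sumr_ge0.
  move=> /mapP[p /tnthP[r ->] ->]; rewrite (bigD1 r) ?Pq ?eqxx //= lerDl.
  exact: sumr_ge0.
apply: le_trans (ler_sum _ (fun r _ => role_rare v r)) _.
by rewrite sumr_const card_ord mulr_natl.
Qed.

End Pattern.
End EulerianSampling.

(** * Avoiding three orientations of the four-cycle *)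

Section Patterns.
Local Open Scope ring_scope.
Variables (D : digraph) (M C : nat).
Hypothesis D_eulerian : eulerian D.
Hypothesis M_gt0 : (0 < M)%N.
Hypothesis C_large : (sampling_threshold M <= C)%N.
Hypothesis D_large : min_outdeg_ge D C.

Local Notation quad := (D * D * D * D)%type.
Local Notation delta := (@inv_deg D).

Lemma walk_role_rare (P : pred quad) (arcs : quad -> 4.-tuple (D * D)) (v : D) (r : 'I_4)
    (io : D * D * D -> quad) (pi : quad -> D * D * D)
    (K1 : D -> rat) (K2 : D -> D -> rat) (K3 : D -> D -> D -> rat) :
    (forall q, (tnth (arcs q) r).1 == v -> io (pi q) = q) ->
    (forall x, 0 <= K1 x) -> (forall x y, 0 <= K2 x y) -> (forall x y z, 0 <= K3 x y z) ->
    \sum_x K1 x <= 1 -> (forall x, \sum_y K2 x y <= 1) ->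
    (forall x y, \sum_z K3 x y z <= 1) ->
    (forall x y z, P (io (x, y, z)) -> \prod_(p <- arcs (io (x, y, z))) delta p.1 <=
       C%:R^-1 * (K1 x * (K2 x y * K3 x y z))) ->
  \sum_(q | P q && ((tnth (arcs q) r).1 == v)) \prod_(p <- arcs q) delta p.1 <= C%:R^-1.
Proof.
move=> ioK K10 K20 K30 K1s K2s K3s PK; rewrite big_mkcondl /=.
apply: (sum_walk_le ioK _ _ K10 K20 K1s K2s K3s).
- by move=> q; case: ifP => // _; apply: prodr_ge0 => p _; apply: inv_deg_ge0.
- by rewrite invr_ge0 ler0n.
- move=> x y z; case: ifP => [/PK //|_].
  by rewrite !mulr_ge0 ?invr_ge0 ?ler0n.
Qed.

Let out_ge0 := @out_step_ge0 D.
Let in_ge0 := @in_step_ge0 D.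
Let sum_out u : \sum_v out_step u v <= 1 := sum_out_step M_gt0 C_large D_large u.
Let sum_in v : \sum_u in_step u v <= 1 := sum_in_step D_eulerian M_gt0 C_large D_large v.
Let delta_le v : delta v <= C%:R^-1 := inv_deg_le M_gt0 C_large D_large v.
Let delta_ge0 := @inv_deg_ge0 D.

(** Seen from any of its vertices, a directed four-cycle is a walk of three
    steps; the out-degree of the fourth vertex makes it rare. *)
Lemma exists_directed_C4_free : exists H : D -> {set D},
  (forall v, H v \subset [set w | adj v w] /\ #|H v| = M) /\
  (forall a b c d, uniq [:: a; b; c; d] ->
     ~~ [&& b \in H a, c \in H b, d \in H c & a \in H d]).
Proof.
pose P (q : quad) := let: (a, b, c, d) := q in
  uniq [:: a; b; c; d] && [&& adj a b, adj b c, adj c d & adj d a].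
pose arcs (q : quad) := let: (a, b, c, d) := q in
  [tuple (a, b); (b, c); (c, d); (d, a)].
have [v|[[[a b] c] d] /andP[u _]|v r|H [HA HP]] := @sampling D M C M_gt0 C_large D_large
    (fun v => [set w | adj v w]) P arcs.
- by rewrite leq_pmull.
- apply: (@map_uniq _ _ fst).
  exact: u.
- have weightE a b c d :
    \prod_(p <- arcs (a, b, c, d)) delta p.1 = delta a * (delta b * (delta c * delta d)).
    by rewrite /= !big_cons big_nil mulr1.
  case: r => -[|[|[|[|//]]]] r_lt.
  + refine (@walk_role_rare P arcs v _ (fun t => let: (b, c, d) := t in (v, b, c, d))
      (fun q => let: (a, b, c, d) := q in (b, c, d))
      (out_step v) (@out_step D) (fun _ => @out_step D)
      _ _ _ _ _ _ _ _) => //.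
      by case=> [[[a b] c] d] /eqP <-.
    move=> b c d /andP[_ /and4P[ab bc cd da]]; rewrite weightE /out_step ab bc cd !mul1r.
    have -> : delta v * (delta b * (delta c * delta d)) =
      delta d * (delta v * (delta b * delta c)) by ring.
    exact: ler_trade.
  + refine (@walk_role_rare P arcs v _ (fun t => let: (c, d, a) := t in (a, v, c, d))
      (fun q => let: (a, b, c, d) := q in (c, d, a))
      (out_step v) (@out_step D) (fun _ => @out_step D)
      _ _ _ _ _ _ _ _) => //.
      by case=> [[[a b] c] d] /eqP <-.
    move=> c d a /andP[_ /and4P[ab bc cd da]]; rewrite weightE /out_step bc cd da !mul1r.
    exact: ler_trade.
  + refine (@walk_role_rare P arcs v _ (fun t => let: (d, a, b) := t in (a, b, v, d))
      (fun q => let: (a, b, c, d) := q in (d, a, b))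
      (out_step v) (@out_step D) (fun _ => @out_step D)
      _ _ _ _ _ _ _ _) => //.
      by case=> [[[a b] c] d] /eqP <-.
    move=> d a b /andP[_ /and4P[ab bc cd da]]; rewrite weightE /out_step cd da ab !mul1r.
    have -> : delta a * (delta b * (delta v * delta d)) =
      delta b * (delta v * (delta d * delta a)) by ring.
    exact: ler_trade.
  + refine (@walk_role_rare P arcs v _ (fun t => let: (a, b, c) := t in (a, b, c, v))
      (fun q => let: (a, b, c, d) := q in (a, b, c))
      (out_step v) (@out_step D) (fun _ => @out_step D)
      _ _ _ _ _ _ _ _) => //.
      by case=> [[[a b] c] d] /eqP <-.
    move=> a b c /andP[_ /and4P[ab bc cd da]]; rewrite weightE /out_step da ab bc !mul1r.
    have -> : delta a * (delta b * (delta c * delta v)) =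
      delta c * (delta v * (delta a * delta b)) by ring.
    exact: ler_trade.
exists H; split=> // a b c d abcd; apply/negP => /and4P[ab bc cd da].
have adjH x y : y \in H x -> adj x y by move=> /(subsetP (HA x).1); rewrite inE.
have := HP (a, b, c, d); rewrite /P abcd !adjH //= => /(_ isT).
by rewrite ab bc cd da.
Qed.

(** Here [b] and [d] see the pattern through their in-neighbour [a], and the
    number of in-neighbours of [b] is its out-degree. *)
Lemma exists_two_paths_free : exists H : D -> {set D},
  (forall v, H v \subset [set w | adj v w] /\ #|H v| = M) /\
  (forall a b c d, uniq [:: a; b; c; d] ->
     ~~ [&& b \in H a, d \in H a, c \in H b & c \in H d]).
Proof.
pose P (q : quad) := let: (a, b, c, d) := q in
  uniq [:: a; b; c; d] && [&& adj a b, adj a d, adj b c & adj d c].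
pose arcs (q : quad) := let: (a, b, c, d) := q in
  [tuple (a, b); (a, d); (b, c); (d, c)].
have [v|[[[a b] c] d] /andP[]|v r|H [HA HP]] := @sampling D M C M_gt0 C_large D_large
    (fun v => [set w | adj v w]) P arcs.
- by rewrite leq_pmull.
- rewrite /= !inE !xpair_eqE !negb_or => /and3P[/and3P[/negPf-> _ /negPf->] /andP[_ /negPf bd] _] _.
  by rewrite bd !andbF.
- have weightE a b c d :
    \prod_(p <- arcs (a, b, c, d)) delta p.1 = delta a * (delta a * (delta b * delta d)).
    by rewrite /= !big_cons big_nil mulr1.
  have tail_rare r' : (forall q : quad, (tnth (arcs q) r').1 = q.1.1.1) ->
      \sum_(q | P q && ((tnth (arcs q) r').1 == v)) \prod_(p <- arcs q) delta p.1 <= C%:R^-1.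
    move=> tailE; refine (@walk_role_rare P arcs v _ (fun t => let: (b, d, c) := t in (v, b, c, d))
      (fun q => let: (a, b, c, d) := q in (b, d, c))
      (out_step v) (fun _ => out_step v) (fun b _ => out_step b)
      _ _ _ _ _ _ _ _) => //.
      by move=> q; rewrite tailE; case: q => [[[a b] c] d] /eqP <-.
    move=> b d c /andP[_ /and4P[ab ad bc dc]]; rewrite weightE /out_step ab ad bc !mul1r.
    have -> : delta v * (delta v * (delta b * delta d)) =
      delta d * (delta v * (delta v * delta b)) by ring.
    exact: ler_trade.
  case: r => -[|[|[|[|//]]]] r_lt.
  + by apply: tail_rare => -[[[a b] c] d].
  + by apply: tail_rare => -[[[a b] c] d].
  + refine (@walk_role_rare P arcs v _ (fun t => let: (a, d, c) := t in (a, v, c, d))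
      (fun q => let: (a, b, c, d) := q in (a, d, c))
      (fun a => in_step a v) (@out_step D) (fun _ => @out_step D)
      _ _ _ _ _ _ _ _) => //.
      by case=> [[[a b] c] d] /eqP <-.
    move=> a d c /andP[_ /and4P[ab ad bc dc]].
    rewrite weightE /out_step /in_step ab ad dc !mul1r.
    have -> : delta a * (delta a * (delta v * delta d)) =
      delta a * (delta v * (delta a * delta d)) by ring.
    exact: ler_trade.
  + refine (@walk_role_rare P arcs v _ (fun t => let: (a, b, c) := t in (a, b, c, v))
      (fun q => let: (a, b, c, d) := q in (a, b, c))
      (fun a => in_step a v) (@out_step D) (fun _ => @out_step D)
      _ _ _ _ _ _ _ _) => //.
      by case=> [[[a b] c] d] /eqP <-.
    move=> a b c /andP[_ /and4P[ab ad bc dc]].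
    rewrite weightE /out_step /in_step ab ad bc !mul1r.
    have -> : delta a * (delta a * (delta b * delta v)) =
      delta a * (delta v * (delta a * delta b)) by ring.
    exact: ler_trade.
exists H; split=> // a b c d abcd; apply/negP => /and4P[ab ad bc dc].
have adjH x y : y \in H x -> adj x y by move=> /(subsetP (HA x).1); rewrite inE.
have := HP (a, b, c, d); rewrite /P abcd !adjH //= => /(_ isT).
by rewrite ab ad bc dc.
Qed.

(** In the pattern [a -> b -> c -> d], [a -> d], the vertex [b] sees [outdeg b]
    possible [a], each with the weight [(outdeg a)^-2] of the two arcs out of
    [a]; the steps to [c] and [d] sum to at most 1. Hence the restriction to
    vertices [a] in [low], whose out-neighbours have degrees well below the
    square of that of [a]. *)
Lemma exists_shortcut_free (A : D -> {set D}) (low : pred D) :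
    (forall v, A v \subset [set w | adj v w]) ->
    (forall v, outdeg v <= 2 * #|A v|)%N ->
    (forall a b, low a -> b \in A a -> C * outdeg b <= outdeg a ^ 2)%N ->
  exists H : D -> {set D},
  (forall v, H v \subset A v /\ #|H v| = M) /\
  (forall a b c d, low a -> uniq [:: a; b; c; d] ->
     ~~ [&& b \in H a, d \in H a, c \in H b & d \in H c]).
Proof.
move=> A_adj A_half low_arc.
have adjA x y : y \in A x -> adj x y by move=> /(subsetP (A_adj x)); rewrite inE.
pose P (q : quad) := let: (a, b, c, d) := q in
  [&& low a, uniq [:: a; b; c; d] & [&& b \in A a, d \in A a, c \in A b & d \in A c]].
pose arcs (q : quad) := let: (a, b, c, d) := q in
  [tuple (a, b); (a, d); (b, c); (c, d)].
have [//|[[[a b] c] d] /and3P[_]|v r|H [HA HP]] := @sampling D M C M_gt0 C_large D_large A P arcs.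
- rewrite /= !inE !xpair_eqE !negb_or.
  move=> /and3P[/and3P[/negPf-> /negPf-> _] /andP[/negPf-> /negPf bd] _] _.
  by rewrite bd !andbF.
- have weightE a b c d :
    \prod_(p <- arcs (a, b, c, d)) delta p.1 = delta a * (delta a * (delta b * delta c)).
    by rewrite /= !big_cons big_nil mulr1.
  have tail_rare r' : (forall q : quad, (tnth (arcs q) r').1 = q.1.1.1) ->
      \sum_(q | P q && ((tnth (arcs q) r').1 == v)) \prod_(p <- arcs q) delta p.1 <= C%:R^-1.
    move=> tailE; refine (@walk_role_rare P arcs v _ (fun t => let: (b, c, d) := t in (v, b, c, d))
      (fun q => let: (a, b, c, d) := q in (b, c, d))
      (out_step v) (@out_step D) (fun _ => @out_step D)
      _ _ _ _ _ _ _ _) => //.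
      by move=> q; rewrite tailE; case: q => [[[a b] c] d] /eqP <-.
    move=> b c d /and3P[_ _ /and4P[/adjA ab /adjA ad /adjA bc /adjA cd]].
    by rewrite weightE /out_step ab bc cd !mul1r; apply: ler_trade.
  case: r => -[|[|[|[|//]]]] r_lt.
  + by apply: tail_rare => -[[[a b] c] d].
  + by apply: tail_rare => -[[[a b] c] d].
  + refine (@walk_role_rare P arcs v _ (fun t => let: (a, c, d) := t in (a, v, c, d))
      (fun q => let: (a, b, c, d) := q in (a, c, d))
      (fun a => in_step a v) (fun _ => out_step v) (fun _ => @out_step D)
      _ _ _ _ _ _ _ _) => //.
      by case=> [[[a b] c] d] /eqP <-.
    move=> a c d /and3P[low_a _ /and4P[ab /adjA ad /adjA bc /adjA cd]].
    have := low_arc _ _ low_a ab => low_av; have {}ab := adjA _ _ ab.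
    rewrite weightE /out_step /in_step ab bc cd !mul1r.
    rewrite [leLHS]mulrA [leRHS]mulrA ler_wpM2r ?mulr_ge0 //.
    have deg_gt0 := outdeg_gt0 M_gt0 C_large D_large.
    have C_gt0 : (0 < C)%N.
      by apply: leq_trans C_large; rewrite /sampling_threshold -lock muln_gt0 expn_gt0 M_gt0.
    rewrite /inv_deg -!invfM lef_pV2 ?posrE ?mulr_gt0 ?ltr0n //.
    by rewrite -!natrM ler_nat.
  + refine (@walk_role_rare P arcs v _ (fun t => let: (b, a, d) := t in (a, b, v, d))
      (fun q => let: (a, b, c, d) := q in (b, a, d))
      (fun a => in_step a v) (fun b a => in_step a b) (fun _ => @out_step D)
      _ _ _ _ _ _ _ _) => //.
      by case=> [[[a b] c] d] /eqP <-.
    move=> b a d /and3P[_ _ /and4P[/adjA ab /adjA ad /adjA bc /adjA cd]].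
    rewrite weightE /out_step /in_step ab bc ad !mul1r.
    have -> : delta a * (delta a * (delta b * delta v)) =
      delta a * (delta v * (delta b * delta a)) by ring.
    exact: ler_trade.
exists H; split=> // a b c d low_a abcd; apply/negP => /and4P[ab ad bc cd].
have inA x y : y \in H x -> y \in A x by move=> /(subsetP (HA x).1).
have := HP (a, b, c, d); rewrite /P low_a abcd !inA //= => /(_ isT).
by rewrite ab ad bc cd.
Qed.

End Patterns.

(** * Avoiding shortcuts everywhere *)

Lemma exists_subset_card (T : finType) (k : nat) (U : {set T}) :
  k <= #|U| -> exists2 S : {set T}, S \subset U & #|S| = k.
Proof.
move=> kU; have [||S [SU Sk _]] := @exists_independent_subset T (fun _ _ => false) 0 k U.
- move=> x _; rewrite (_ : [set y in U | false] = set0) ?cards0 //.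
  by apply/setP => y; rewrite !inE andbF.
- by rewrite muln0 muln1.
- by exists S.
Qed.

Section ShortcutFree.
Variable k : nat.
Hypothesis k_gt0 : 0 < k.

(** A vertex first samples [2 * half_sample] out-neighbours, then keeps
    [reserve] of them in almost disjoint lists, then [k] of them that are
    independent in an auxiliary digraph of out-degree [k * k]; [overlap_cap] is
    the bound [mu] of [exists_almost_disjoint_subsets]. *)
Definition reserve : nat := k * (2 * (k * k)).+1.
Definition overlap_cap : nat := 4 * k * reserve.
Definition half_sample : nat := reserve * (2 * (overlap_cap * reserve)).+1.
Local Notation M := (2 * half_sample).
Local Notation C := (sampling_threshold M).

Lemma reserve_ge : k <= reserve.
Proof. by rewrite leq_pmulr. Qed.

Lemma half_sample_ge : reserve <= half_sample.
Proof. by rewrite leq_pmulr. Qed.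

Lemma sample_ge : k <= M.
Proof.
apply: leq_trans reserve_ge _; apply: leq_trans half_sample_ge _.
by rewrite leq_pmull.
Qed.

Section Digraph.
Variable D : digraph.
Hypothesis D_eulerian : eulerian D.
Hypothesis D_large : min_outdeg_ge D C.

(** An arc is a jump when its head has a degree beyond the reach of the sampling
    argument. Each vertex keeps only its jumps, or only its other arcs,
    whichever are more numerous. *)
Definition jump (u v : D) : bool := adj u v && (outdeg u ^ 2 < C * outdeg v).
Definition jumpy (u : D) : bool := outdeg u <= 2 * #|[set v | jump u v]|.
Definition kept_arcs (u : D) : {set D} :=
  if jumpy u then [set v | jump u v] else [set v | adj u v && ~~ jump u v].

Lemma jump_outdeg u v : jump u v -> outdeg u < outdeg v.
Proof.
move=> /andP[_ lt]; have C_gt0 : 0 < C.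
  by case: C lt; rewrite // mul0n ltn0.
rewrite -(ltn_pmul2l C_gt0); apply: leq_ltn_trans lt.
by rewrite expnS expn1 leq_mul2r D_large orbT.
Qed.

Lemma kept_arcs_adj u : kept_arcs u \subset [set v | adj u v].
Proof.
by apply/subsetP => v; rewrite /kept_arcs; case: ifP => _; rewrite !inE => /andP[].
Qed.

Lemma kept_arcs_half u : outdeg u <= 2 * #|kept_arcs u|.
Proof.
rewrite /kept_arcs; case: ifP => //; move/negbT; rewrite /jumpy -ltnNge => lt.
have degE : outdeg u = #|[set v | jump u v]| + #|[set v | adj u v && ~~ jump u v]|.
  rewrite /outdeg -(cardsID [set v | jump u v]); congr (_ + _).
    by apply: eq_card => v; rewrite !inE /jump andbA andbb.
  by apply: eq_card => v; rewrite !inE andbC.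
move: lt; rewrite degE !mul2n -!addnn ltn_add2l => lt.
by rewrite leq_add2r ltnW.
Qed.

(** Sampling excludes the shortcuts at the vertices that are not [jumpy], and
    these vertices then choose their final lists [W] at once. A jumpy vertex [a]
    must choose among its sample so that no chosen [b] leads in two steps to a
    chosen [d]. If the middle vertex [c] is jumpy and [b] is not, the lists of
    [a] and [c] are first made almost disjoint; since [b] has already chosen,
    only boundedly many [c] concern [a]. In the remaining cases the lists of [b]
    and [c] are already final when [a] chooses, provided that jumpy vertices
    choose in decreasing order of their degrees, because jumps increase the
    degree. Then each [b] excludes at most [k * k] elements [d]. *)
Lemma exists_shortcut_free_in : exists H : D -> {set D},
  (forall v, H v \subset [set w | adj v w] /\ #|H v| = k) /\
  (forall a b c d, uniq [:: a; b; c; d] ->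
     ~~ [&& b \in H a, d \in H a, c \in H b & d \in H c]).
Proof.
have M_gt0 : 0 < M by apply: leq_trans sample_ge.
have low_arc a b : ~~ jumpy a -> b \in kept_arcs a -> C * outdeg b <= outdeg a ^ 2.
  by rewrite /kept_arcs => /negPf->; rewrite inE => /andP[ab]; rewrite /jump ab -leqNgt.
have [H [HA Hlow]] := exists_shortcut_free D_eulerian M_gt0 (leqnn _) D_large
  kept_arcs_adj kept_arcs_half low_arc.
have jumpH u v : jumpy u -> v \in H u -> outdeg u < outdeg v.
  move=> ju /(subsetP (HA u).1); rewrite /kept_arcs ju inE; exact: jump_outdeg.
have /fin_all_exists[W WP] v : exists S : {set D}, S \subset H v /\ #|S| = k.
  by have [|S] := @exists_subset_card D k (H v); [rewrite (HA v).2 sample_ge|exists S].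
(* [cut a c]: some two-step path leads from [a] to [c] through a final list. *)
pose cut a c := [exists b in H a, ~~ jumpy b && (c \in W b)].
have [||||Y [YH Ycut]] := @exists_almost_disjoint_subsets D D [set v | jumpy v] H cut
    (M * k) reserve overlap_cap half_sample.
- by rewrite /overlap_cap 2!muln_gt0 k_gt0 (leq_trans k_gt0 reserve_ge).
- have assoc (a b c : nat) : 2 * (2 * a * b) * c = 2 * 2 * b * c * a.
    by rewrite -!mulnA (mulnC a) -!mulnA.
  by rewrite assoc leqnn.
- move=> a _; apply: leq_trans (_ : #|\bigcup_(b in H a) W b| <= _).
    apply/subset_leq_card/subsetP => c; rewrite inE => /andP[_ /existsP[b /and3P[ab _ bc]]].
    by apply/bigcupP; exists b.
  apply: leq_trans (_ : \sum_(b in H a) #|W b| <= _); first exact: card_bigcup_leq.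
  rewrite (eq_bigr (fun=> k)); last by move=> b _; rewrite (WP b).2.
  by rewrite sum_nat_const (HA a).2.
- by move=> a _; rewrite (HA a).2 [leqRHS]mul2n -addnn.
pose conflict_free (T : D -> {set D}) a := forall b c d,
  uniq [:: a; b; c; d] -> ~~ [&& b \in T a, d \in T a, c \in T b & d \in T c].
(* After [n] rounds the jumpy vertices of degree above [#|D| - n] have their final
   lists. Lists only shrink, so a vertex that is free of shortcuts remains so. *)
have refine n : exists T : D -> {set D},
    [/\ forall v, T v \subset if jumpy v then Y v else W v,
        forall v, ~~ jumpy v -> #|T v| = k &
        forall v, jumpy v -> if #|D| < outdeg v + n
          then #|T v| = k /\ conflict_free T v else T v = Y v].
  elim: n => [|n [T [T0 Tlow Tjump]]].
    exists (fun v => if jumpy v then Y v else W v); split=> [v|v /negPf->|v ->] //.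
      exact: (WP v).2.
    by rewrite addn0 ltnNge max_card.
  pose current v := jumpy v && (#|D| == outdeg v + n).
  have YT v : current v -> T v = Y v.
    by move=> /andP[jv /eqP Dv]; have := Tjump v jv; rewrite Dv ltnn.
  have above v b : current v -> jumpy b -> outdeg v < outdeg b -> #|T b| = k.
    move=> /andP[_ /eqP Dv] jb vb; have := Tjump b jb.
    by rewrite Dv ltn_add2r vb => -[].
  have T_H v : T v \subset H v.
    apply: subset_trans (T0 v) _; case: ifP => jv; last exact: (WP v).1.
    by apply: (YH v _).1; rewrite inE.
  have /fin_all_exists[S SP] v : exists S : {set D}, if current v
      then [/\ S \subset T v, #|S| = k & forall b c d, uniq [:: v; b; c; d] ->
        ~~ [&& b \in S, d \in S, c \in T b & d \in T c]]
      else S = T v.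
    case: (boolP (current v)) => [cv|_]; last by exists (T v).
    have jv : jumpy v by case/andP: cv.
    pose clash b d := [exists c, [&& c != v, c \in T b & d \in T c]].
    have [||S [SY Sk Sfree]] := @exists_independent_subset D clash (k * k) k (T v).
    - move=> b; rewrite (YT _ cv) => bY.
      have bH : b \in H v by apply: subsetP (YH v _).1 _ bY; rewrite inE.
      have vb := jumpH v b jv bH.
      have Tb : #|T b| = k.
        by have [jb|/Tlow//] := boolP (jumpy b); apply: above cv jb vb.
      apply: leq_trans (_ : #|\bigcup_(c in T b :\ v) (T c :&: Y v)| <= _).
        apply/subset_leq_card/subsetP => d; rewrite inE => /andP[dY /existsP[c /and3P[cv' bc cd]]].
        by apply/bigcupP; exists c; rewrite inE ?cd // inE cv'.
      apply: leq_trans (_ : \sum_(c in T b :\ v) #|T c :&: Y v| <= _); first exact: card_bigcup_leq.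
      apply: leq_trans (_ : \sum_(c in T b :\ v) k <= _); last first.
        rewrite sum_nat_const leq_mul2r -[leqRHS]Tb subset_leq_card ?orbT //.
        exact: subsetDl.
      apply: leq_sum => c /setD1P[cv' bc].
      have sub_k : #|T c| = k -> #|T c :&: Y v| <= k.
        by move=> <-; rewrite subset_leq_card ?subsetIl.
      have [jc|/Tlow/sub_k//] := boolP (jumpy c).
      have [jb|lb] := boolP (jumpy b).
        apply: sub_k; apply: above cv jc (ltn_trans vb _).
        exact: jumpH jb (subsetP (T_H b) _ bc).
      apply: leq_trans (_ : #|Y v :&: Y c| <= _).
        by rewrite setIC subset_leq_card // setIS //; have := T0 c; rewrite jc.
      apply: leq_trans k_gt0; apply: Ycut; rewrite ?inE //; first by rewrite eq_sym.
      apply/existsP; exists b; rewrite bH lb /=.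
      by have := subsetP (T0 b) _ bc; rewrite (negPf lb).
    - by rewrite (YT _ cv) (YH v _).2 // inE.
    exists S; split=> // b c d; rewrite /= !inE !negb_or.
    move=> /and4P[/and3P[vb vc vd] /andP[bc bd] cd _].
    apply/negP => /and4P[bS dS cT dT].
    have /negP[] := Sfree b d bS dS bd.
    by apply/existsP; exists c; rewrite cT dT eq_sym vc.
  have ST v : S v \subset T v by have := SP v; case: ifP => [_ []|_ ->].
  exists S; split=> [v|v lv|v jv].
  - exact: subset_trans (ST v) (T0 v).
  - by have := SP v; rewrite /current (negPf lv) /= => ->; apply: Tlow.
  have := SP v; rewrite /current jv /= addnS ltnS leq_eqVlt.
  have [_ /= [_ Sk Sfree]|_ /= Sv] := eqVneq #|D| (outdeg v + n).
    split=> // b c d abcd; apply: contra (Sfree b c d abcd) => /and4P[-> -> bc cd] /=.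
    by rewrite (subsetP (ST b) _ bc) (subsetP (ST c) _ cd).
  have := Tjump v jv; case: ifP => _; last by rewrite Sv.
  move=> [Tk Tfree]; split; first by rewrite Sv.
  move=> b c d abcd; apply: contra (Tfree b c d abcd); rewrite Sv => /and4P[-> -> bc cd] /=.
  by rewrite (subsetP (ST b) _ bc) (subsetP (ST c) _ cd).
have [T [T0 Tlow Tjump]] := refine #|D|.+1.
have done v : #|D| < outdeg v + #|D|.+1 by rewrite addnS ltnS leq_addl.
have T_H v : T v \subset H v.
  apply: subset_trans (T0 v) _; case: ifP => jv; last exact: (WP v).1.
  by apply: (YH v _).1; rewrite inE.
exists T; split=> [v|a b c d abcd].
  split; first exact: subset_trans (T_H v) (subset_trans (HA v).1 (kept_arcs_adj v)).
  by have [jv|/Tlow//] := boolP (jumpy v); have := Tjump v jv; rewrite done => -[].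
have [ja|la] := boolP (jumpy a).
  by have := Tjump a ja; rewrite done => -[_]; apply.
apply: contra (Hlow a b c d la abcd) => /and4P[ab ad bc cd].
have inH x y : y \in T x -> y \in H x by apply: subsetP.
by rewrite !inH.
Qed.

End Digraph.
End ShortcutFree.

(** * Eulerian digraphs in which two common out-neighbours are forced *)

(** The leaves of the tree are the words of length [n.+1] over [m.+1] letters,
    the nodes are the nonempty proper prefixes. A leaf points to all its
    prefixes, and a node points to all the leaves below its next sibling in
    cyclic order. Siblings have equally many leaves below them, so the digraph
    is Eulerian. *)
Section CyclicTree.
Variables n m : nat.

Local Notation word := {ffun 'I_n.+1 -> 'I_m.+1}.

(** The prefix of length [j.+1], padded with [ord0] so that all prefixes live in
    the type of words. *)
Definition prefix_of (j : 'I_n) (x : word) : word :=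
  [ffun i : 'I_n.+1 => if i <= j then x i else ord0].

Definition turn (j : 'I_n) (x : word) : word :=
  [ffun i : 'I_n.+1 => if (i == j :> nat) then ordS (x i) else x i].

Local Notation node := {q : 'I_n * word | prefix_of q.1 q.2 == q.2}.

Lemma prefix_of_idem j x : prefix_of j (prefix_of j x) = prefix_of j x.
Proof. by apply/ffunP => i; rewrite !ffunE; case: (i <= j). Qed.

Lemma prefix_of_turn j x : prefix_of j (turn j x) = turn j (prefix_of j x).
Proof.
apply/ffunP => i; rewrite !ffunE; case: ifP => // ij.
by case: eqP => // e; rewrite e leqnn in ij.
Qed.

Lemma turn_inj j : injective (turn j).
Proof.
move=> x y /ffunP xy; apply/ffunP => i; have := xy i; rewrite !ffunE.
by case: ifP => // _; apply: ordS_inj.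
Qed.

Fact node_of_subproof j x : prefix_of j (prefix_of j x) == prefix_of j x.
Proof. by rewrite prefix_of_idem. Qed.

Definition node_of j x : node := Sub (j, prefix_of j x) (node_of_subproof j x).

Definition tree_adj (u v : word + node) : bool :=
  match u, v with
  | inl x, inr q => prefix_of (val q).1 x == (val q).2
  | inr q, inl x => prefix_of (val q).1 x == turn (val q).1 (val q).2
  | _, _ => false
  end.

Lemma tree_adj_irr : irreflexive tree_adj.
Proof. by case. Qed.

Definition cyclic_tree : digraph := Digraph tree_adj_irr.

Lemma tree_adj_leaf x q : tree_adj (inl x) (inr q) -> q = node_of (val q).1 x.
Proof. by case: q => [[j p] /= pp] /eqP xp; apply: val_inj; rewrite /= xp. Qed.

Fact turn_node_subproof (q : node) :
  prefix_of (val q).1 (turn (val q).1 (val q).2) == turn (val q).1 (val q).2.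
Proof. by rewrite prefix_of_turn (eqP (valP q)). Qed.

Definition turn_node (q : node) : node :=
  Sub ((val q).1, turn (val q).1 (val q).2) (turn_node_subproof q).

Lemma turn_node_inj : injective turn_node.
Proof.
move=> [[j p] pp] [[j' p'] pp'] /(congr1 val) /= [jj ppE].
by apply: val_inj; move: ppE; rewrite /= -jj => /turn_inj->.
Qed.

Lemma cyclic_tree_eulerian : eulerian cyclic_tree.
Proof.
case=> [x|q]; rewrite /indeg /outdeg.
  pose phi (u : cyclic_tree) : cyclic_tree :=
    match u with inl y => inl y | inr q => inr (turn_node q) end.
  have phi_inj : injective phi.
    by case=> [y|q] [z|r] //= e; congr inr; apply: turn_node_inj (inr_inj e).
  rewrite -[RHS](on_card_preimset (f := phi)); last exact/onW_bij/injF_bij.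
  by apply: eq_card => -[y|r]; rewrite !inE.
pose phi (u : cyclic_tree) : cyclic_tree :=
  match u with inl y => inl (turn (val q).1 y) | inr r => inr r end.
have phi_inj : injective phi.
  by case=> [y|r] [z|s] //= e; congr inl; apply: turn_inj (inl_inj e).
rewrite -[RHS](on_card_preimset (f := phi)); last exact/onW_bij/injF_bij.
apply: eq_card => -[y|r]; rewrite !inE //=.
by rewrite prefix_of_turn (inj_eq (@turn_inj _)).
Qed.

Lemma cyclic_tree_outdeg d : d <= n -> d <= m.+1 -> min_outdeg_ge cyclic_tree d.
Proof.
move=> dn dm [x|q].
  apply: leq_trans dn _; rewrite -[leqLHS]card_ord.
  have inj : injective (fun j : 'I_n => inr (node_of j x) : cyclic_tree) by move=> i j [].
  rewrite -(card_imset _ inj); apply/subset_leq_card/subsetP => _ /imsetP[j _ ->].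
  by rewrite inE /=.
apply: leq_trans dm _; rewrite -[leqLHS]card_ord.
pose leaf z : word := [ffun i : 'I_n.+1 => if i == ord_max then z else turn (val q).1 (val q).2 i].
have inj : injective (fun z => inl (leaf z) : cyclic_tree).
  by move=> y z [] /ffunP/(_ ord_max); rewrite !ffunE eqxx.
rewrite -(card_imset _ inj); apply/subset_leq_card/subsetP => _ /imsetP[z _ ->].
rewrite inE /= -[X in _ == X](eqP (turn_node_subproof q)); apply/eqP/ffunP => i; rewrite !ffunE.
by case: (eqVneq i ord_max) => [->|] //=; rewrite leqNgt ltn_ord.
Qed.

Section Subdigraph.
Variable H : subdigraph cyclic_tree.
Hypothesis n2m : n * n <= m.
Hypothesis H0 : nonempty H.
Hypothesis H3 : min_outdeg_ge H 3.

Local Notation S := (sub_verts H).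
Local Notation R := (sub_arc H).

Definition agree l (x y : word) := [forall i : 'I_n.+1, (i < l) ==> (x i == y i)].

Definition used (x : word) l : {set 'I_n} :=
  [set j : 'I_n | (j < l) && R (inl x) (inr (node_of j x))].

Lemma agree_prefix l x y (j : 'I_n) : agree l x y -> j < l -> node_of j x = node_of j y.
Proof.
move=> /forallP xy jl; apply: val_inj => /=; congr (_, _); apply/ffunP => i; rewrite !ffunE.
case: ifP => // ij; apply/eqP; have := xy i; rewrite (leq_ltn_trans ij jl); exact.
Qed.

Lemma agree_trans l x y z : agree l x y -> agree l y z -> agree l x z.
Proof.
move=> /forallP xy /forallP yz; apply/forallP => i; apply/implyP => il.
by have := xy i; have := yz i; rewrite il => /eqP <- /eqP ->.
Qed.

Lemma agreeW l x y : agree l.+1 x y -> agree l x y.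
Proof.
move=> /forallP xy; apply/forallP => i; apply/implyP => /ltnW il.
by have := xy i; rewrite ltnS il.
Qed.

Lemma outdeg_sub (u : cyclic_tree) : u \in S -> 3 <= #|[set v | R u v]|.
Proof.
move=> uS; apply: leq_trans (H3 (Sub u uS : H)) _.
rewrite /outdeg -(card_imset _ val_inj); apply/subset_leq_card/subsetP => _ /imsetP[v uv ->].
by move: uv; rewrite !inE.
Qed.

Lemma node_has_leaf q : inr q \in S ->
  exists x, inl x \in S /\ prefix_of (val q).1 x = turn (val q).1 (val q).2.
Proof.
move=> /outdeg_sub /(leq_trans (isT : 0 < 3)) /card_gt0P[v]; rewrite inE.
by case: v => [x|r] /sub_arcP[_ vS //] /eqP; exists x.
Qed.

Lemma exists_leaf : exists x, inl x \in S.
Proof.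
have /card_gt0P[[[x|q] qS] _] := H0; first by exists x.
by have [x [xS _]] := node_has_leaf qS; exists x.
Qed.

Lemma val_iter_ordS t (z : 'I_m.+1) : val (iter t (@ordS _) z) = (z + t) %% m.+1.
Proof.
elim: t => [|t IH]; first by rewrite addn0 modn_small.
by rewrite iterS /= IH -[in LHS]addn1 modnDml addn1 addnS.
Qed.

Definition K22_pattern : Prop := exists x y u v,
  [/\ x != y, u != v, R x u && R x v & R y u && R y v].

(** Descent in the tree. Below some node of depth [l], no leaf of [H] uses more
    than two prefixes of length at most [l]. If one of the children above a leaf
    of [H] is absent from [H], it can be entered freely. Otherwise all the
    children that lie above a leaf of [H] belong to [H], and since each points
    to the leaves below its sibling, the cyclic order shows that every child
    lies above a leaf of [H]. If each child had a leaf using two of the earlier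
    prefixes, then two children would use the same pair, because there are more
    than [n * n] children. So some child has only leaves that use at most one
    earlier prefix, hence at most two in all. *)
Lemma exists_few_used_or_K22 l : l <= n -> K22_pattern \/
  exists x0, inl x0 \in S /\
    forall x, inl x \in S -> agree l x0 x -> #|used x l| <= 2.
Proof.
elim: l => [|l IH] ln.
  have [x xS] := exists_leaf; right; exists x; split=> // y _ _.
  by rewrite (_ : used y 0 = set0) ?cards0 //; apply/setP => j; rewrite !inE.
have [K|[x0 [x0S few]]] := IH (ltnW ln); first by left.
pose jl : 'I_n := Ordinal ln; pose il : 'I_n.+1 := widen_ord (leqnSn n) jl.
have used_sub x : used x l.+1 \subset jl |: used x l.
  apply/subsetP => j; rewrite !inE ltnS leq_eqVlt => /andP[/orP[jE|->] ->].
    by rewrite -(inj_eq val_inj) /= jE.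
  by rewrite orbT.
have [/existsP[x1 /and3P[x1S x01 nS]]|] := boolP [exists x1, [&& inl x1 \in S,
    agree l x0 x1 & inr (node_of jl x1) \notin S]].
  right; exists x1; split=> // x xS x1x.
  apply: leq_trans (few x xS (agree_trans x01 (agreeW x1x))).
  apply/subset_leq_card/subsetP => j jx; have := subsetP (used_sub x) j jx.
  case/setU1P => [jE|//]; move: jx; rewrite jE inE => /andP[_ /sub_arcP[_]].
  by rewrite -(agree_prefix x1x (ltnSn l : jl < l.+1)) (negPf nS).
rewrite negb_exists => /forallP nodeS.
have letters c : exists x, [/\ inl x \in S, agree l x0 x & x il = c].
  have [t ->] : exists t, c = iter t (@ordS _) (x0 il).
    exists (c + (m.+1 - x0 il)); apply: val_inj; rewrite val_iter_ordS addnCA.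
    by rewrite subnKC 1?ltnW // modnDr modn_small.
  elim: t => [|t [x [xS x0x xt]]].
    by exists x0; split=> //; apply/forallP => i; rewrite eqxx implybT.
  have qS : inr (node_of jl x) \in S.
    by have := nodeS x; rewrite xS x0x /= negbK.
  have [y [yS]] := node_has_leaf qS; rewrite /= -prefix_of_turn => /ffunP yE.
  exists y; split=> //.
    apply/forallP => i; apply/implyP => il'; have := yE i.
    rewrite !ffunE /= ltnW // (ltn_eqF il') => ->.
    by have /forallP/(_ i) := x0x; rewrite il'.
  by have := yE il; rewrite !ffunE /= leqnn eqxx xt.
pose poor c := [forall x, [&& inl x \in S, agree l x0 x & x il == c] ==> (#|used x l| <= 1)].
have [/existsP[c /forallP poor_c]|] := boolP [exists c, poor c].
  have [x1 [x1S x01 x1c]] := letters c; right; exists x1; split=> // x xS x1x.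
  apply: leq_trans (subset_leq_card (used_sub x)) _.
  apply: leq_trans (leq_card_setU _ _).1 _; rewrite cards1 add1n ltnS.
  have := poor_c x; rewrite xS (agree_trans x01 (agreeW x1x)) -x1c /= => /implyP; apply.
  by have /forallP/(_ il) := x1x; rewrite /= ltnSn eq_sym.
rewrite negb_exists => /forallP rich; left.
have /fin_all_exists[g gP] c : exists x, [/\ inl x \in S, agree l x0 x, x il = c & 1 < #|used x l|].
  have := rich c; rewrite negb_forall => /existsP[x]; rewrite negb_imply -ltnNge.
  by move=> /andP[/and3P[xS x0x /eqP xc] u1]; exists x.
have /fin_all_exists[h hP] c : exists p : 'I_n * 'I_n,
    [/\ p.1 \in used (g c) l, p.2 \in used (g c) l & p.1 != p.2].
  by have [_ _ _ /card_gt1P[i [j [iu ju ij]]]] := gP c; exists (i, j).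
have /injectivePn[c [c' cc' hE]] : ~~ injectiveb h.
  apply: contraTN n2m => /injectiveP/leq_card; rewrite card_prod !card_ord.
  by rewrite -ltnNge.
have [_ x0c gc _] := gP c; have [_ x0c' gc' _] := gP c'.
have [] := hP c; have [] := hP c'; rewrite -hE !inE.
move=> /andP[i_l R1] /andP[j_l R2] ij /andP[_ R3] /andP[_ R4] _.
exists (inl (g c)), (inl (g c')), (inr (node_of (h c).1 (g c))), (inr (node_of (h c).2 (g c))).
have node_eq (j : 'I_n) : j < l -> node_of j (g c') = node_of j (g c).
  by move=> jl'; rewrite -(agree_prefix x0c jl') -(agree_prefix x0c' jl').
split.
- by apply: contraNneq cc' => -[e]; rewrite -gc -gc' e.
- by apply: contraNneq ij => -[e _]; rewrite e.
- by rewrite R3 R4.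
- by rewrite -!node_eq // R1 R2.
Qed.

Lemma cyclic_tree_K22 : K22_pattern.
Proof.
have [//|[x [xS /(_ x xS)]]] := exists_few_used_or_K22 (leqnn n).
have xx : agree n x x by apply/forallP => i; rewrite eqxx implybT.
move=> /(_ xx) le2; have := outdeg_sub xS; rewrite ltnNge; case/negP.
apply: leq_trans le2.
apply: leq_trans (leq_imset_card (fun j => inr (node_of j x) : cyclic_tree) _).
apply/subset_leq_card/subsetP => v; rewrite inE => xv.
have [_ _] := sub_arcP xv; case: v xv => // q xq /tree_adj_leaf qE.
by apply/imsetP; exists (val q).1; rewrite -?qE // inE ltn_ord /= -qE.
Qed.

End Subdigraph.
End CyclicTree.

(** * Orientations of the four-cycle *)

Section Copies.

Lemma digraph_iso_trans (E F G : digraph) :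
  digraph_iso E F -> digraph_iso F G -> digraph_iso E G.
Proof.
move=> [f [bij_f adj_f]] [g [bij_g adj_g]].
by exists (g \o f); split=> [|x y]; [apply: bij_comp | rewrite /= adj_g adj_f].
Qed.

Lemma exists_copy (E D : digraph) (t : E -> D) :
  injective t -> (forall x y, adj x y -> adj (t x) (t y)) ->
  exists K : subdigraph D, digraph_iso E K.
Proof.
move=> t_inj t_adj.
pose arc (a b : D) := [exists x, exists y, [&& adj x y, t x == a & t y == b]].
have arcE x y : arc (t x) (t y) = adj x y.
  apply/existsP/idP => [[x' /existsP[y' /and3P[xy /eqP/t_inj<- /eqP/t_inj<-]]] //|xy].
  by exists x; apply/existsP; exists y; rewrite xy !eqxx.
have arcP (a b : D) : arc a b -> [/\ a \in [set t x | x : E], b \in [set t x | x : E] & adj a b].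
  move=> /existsP[x /existsP[y /and3P[xy /eqP<- /eqP<-]]].
  by split; [apply: imset_f | apply: imset_f | apply: t_adj].
pose K := Subdigraph arcP; exists K.
have in_K x : t x \in sub_verts K by apply: imset_f.
pose f x : K := Sub (t x) (in_K x); exists f; split=> [|x y]; last exact: arcE.
apply: inj_card_bij => [x y /(congr1 val) /t_inj //|].
by rewrite card_sig -(card_imset predT t_inj) subset_leq_card //; apply/subsetP => a.
Qed.

Variables (D : digraph) (H : D -> {set D}).
Hypothesis H_adj : forall v, H v \subset [set w | adj v w].

Fact list_subdigraph_subproof (u v : D) : v \in H u ->
  [/\ u \in [set: D], v \in [set: D] & adj u v].
Proof. by move=> /(subsetP (H_adj u)); rewrite !inE. Qed.

Definition list_subdigraph : subdigraph D :=
  @Subdigraph D [set: D] (fun u v => v \in H u) list_subdigraph_subproof.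

Lemma list_subdigraph_nonempty : nonempty D -> nonempty list_subdigraph.
Proof. by move=> /card_gt0P[v _]; apply/card_gt0P; exists (Sub v (in_setT v)). Qed.

Lemma list_subdigraph_outdeg k : (forall v, #|H v| = k) -> min_outdeg_ge list_subdigraph k.
Proof.
move=> Hk u; rewrite -(Hk (val u)) /outdeg -(card_imset _ val_inj).
apply/subset_leq_card/subsetP => v uv; apply/imsetP.
by exists (Sub v (in_setT v)); rewrite ?inE.
Qed.

Lemma list_subdigraph_free (F : digraph) :
    (forall t : F -> D, injective t -> (forall x y, adj x y -> t y \in H (t x)) -> False) ->
  subdigraph_free F list_subdigraph.
Proof.
move=> noF [K [f [/bij_inj f_inj f_adj]]]; apply: (noF (fun x => val (val (f x)))).
  by move=> x y /val_inj/val_inj/f_inj.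
by move=> x y; rewrite -f_adj => /sub_arcP[].
Qed.

End Copies.

Lemma eulerian_avoidable_lists (F : digraph) :
    (forall k, 0 < k -> exists d, forall D : digraph, eulerian D -> min_outdeg_ge D d ->
      exists H : D -> {set D},
        (forall v, H v \subset [set w | adj v w] /\ #|H v| = k) /\
        (forall t : F -> D, injective t ->
           (forall x y, adj x y -> t y \in H (t x)) -> False)) ->
  eulerian_avoidable F.
Proof.
move=> avoid k k_gt0; have [d dP] := avoid k k_gt0; exists d => D D0 eD dD.
have [H [HA noF]] := dP D eD dD; exists (list_subdigraph (fun v => (HA v).1)); split.
- exact: list_subdigraph_nonempty.
- exact: list_subdigraph_free.
- by apply: list_subdigraph_outdeg => v; apply: (HA v).2.
Qed.

Lemma uniq_inj4 (T T' : eqType) (t : T -> T') (a b c d : T) :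
  injective t -> uniq [:: a; b; c; d] -> uniq [:: t a; t b; t c; t d].
Proof. by move=> t_inj; rewrite -(map_inj_uniq t_inj). Qed.

Section Avoidable.
Variables (F : digraph) (a b c d : F).
Hypothesis abcd : uniq [:: a; b; c; d].

Lemma directed_C4_avoidable :
  [&& adj a b, adj b c, adj c d & adj d a] -> eulerian_avoidable F.
Proof.
move=> /and4P[ab bc cd da]; apply: eulerian_avoidable_lists => k k_gt0.
exists (sampling_threshold k) => D eD dD.
have [H [HA HF]] := exists_directed_C4_free k_gt0 (leqnn _) dD.
exists H; split=> // t t_inj t_arc.
by have := HF _ _ _ _ (uniq_inj4 t_inj abcd); rewrite !t_arc.
Qed.

Lemma two_paths_avoidable :
  [&& adj a b, adj a d, adj b c & adj d c] -> eulerian_avoidable F.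
Proof.
move=> /and4P[ab ad bc dc]; apply: eulerian_avoidable_lists => k k_gt0.
exists (sampling_threshold k) => D eD dD.
have [H [HA HF]] := exists_two_paths_free eD k_gt0 (leqnn _) dD.
exists H; split=> // t t_inj t_arc.
by have := HF _ _ _ _ (uniq_inj4 t_inj abcd); rewrite !t_arc.
Qed.

Lemma shortcut_avoidable :
  [&& adj a b, adj a d, adj b c & adj c d] -> eulerian_avoidable F.
Proof.
move=> /and4P[ab ad bc cd]; apply: eulerian_avoidable_lists => k k_gt0.
exists (sampling_threshold (2 * half_sample k)) => D eD dD.
have [H [HA HF]] := exists_shortcut_free_in k_gt0 eD dD.
exists H; split=> // t t_inj t_arc.
by have := HF _ _ _ _ (uniq_inj4 t_inj abcd); rewrite !t_arc.
Qed.

End Avoidable.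

Lemma K22_not_avoidable (F : digraph) : digraph_iso F K22 -> ~ eulerian_avoidable F.
Proof.
move=> FK /(_ 3 isT)[d dP]; pose D := cyclic_tree d (d * d + d).
have D0 : nonempty D by apply/card_gt0P; exists (inl [ffun=> ord0]).
have dD : min_outdeg_ge D d.
  by apply: cyclic_tree_outdeg => //; rewrite leqW // leq_addl.
have [H [H0 freeH H3]] := dP D D0 (@cyclic_tree_eulerian _ _) dD.
have [x [y [u [v [xy uv /andP[xu xv] /andP[yu yv]]]]]] :=
  cyclic_tree_K22 (leq_addr d (d * d)) H0 H3.
have [xS uS _] := sub_arcP xu; have [yS vS _] := sub_arcP yv.
have neq (a b : D) : sub_arc H a b -> a != b.
  by move=> /sub_arcP[_ _]; apply: contraTneq => ->; rewrite adj_irr.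
pose s : seq H := [:: Sub x xS; Sub u uS; Sub y yS; Sub v vS].
have s_uniq : uniq s.
  rewrite /= !inE -!(inj_eq val_inj) /= !negb_or xy uv (neq _ _ xu) (neq _ _ xv).
  by rewrite (neq _ _ yv) eq_sym (neq _ _ yu).
pose t (i : K22) : H := nth (Sub x xS) s i.
have t_inj : injective t.
  by move=> i j /eqP; rewrite nth_uniq //= => /eqP/val_inj.
have t_adj i j : adj i j -> adj (t i) (t j).
  by case: i j => [[|[|[|[|//]]]] i4] [[|[|[|[|//]]]] j4].
have [K K22K] := exists_copy t_inj t_adj.
by apply: freeH; exists K; apply: digraph_iso_trans FK K22K.
Qed.

Section Orientations.
Variable F : digraph.

Definition has_directed_C4 : Prop := exists a b c d : F,
  uniq [:: a; b; c; d] /\ [&& adj a b, adj b c, adj c d & adj d a].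

Definition has_two_paths : Prop := exists a b c d : F,
  uniq [:: a; b; c; d] /\ [&& adj a b, adj a d, adj b c & adj d c].

Definition has_shortcut : Prop := exists a b c d : F,
  uniq [:: a; b; c; d] /\ [&& adj a b, adj a d, adj b c & adj c d].

Local Notation "''o_' i" := (@Ordinal 4 i isT) (at level 8, i at level 2, format "''o_' i").

Lemma K22_iso (f : 'I_4 -> F) : bijective f ->
    (forall i j, C4 i j = adj (f i) (f j) || adj (f j) (f i)) ->
    (forall i j, ~~ (adj (f i) (f j) && adj (f j) (f i))) ->
    [&& adj (f 'o_0) (f 'o_1), adj (f 'o_2) (f 'o_1),
        adj (f 'o_2) (f 'o_3) & adj (f 'o_0) (f 'o_3)] ->
  digraph_iso F K22.
Proof.
move=> [g fK gK] edge anti /and4P[a01 a21 a23 a03].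
exists g; split=> [|x y]; first by exists f.
rewrite -{2}(gK x) -{2}(gK y); move: (g x) (g y) => i j {x y}.
have back k l : adj (f k) (f l) -> adj (f l) (f k) = false.
  by move=> kl; have := anti k l; rewrite kl => /negPf.
have far k l : C4 k l = false -> adj (f k) (f l) = false.
  by rewrite edge => /negbT; rewrite negb_or => /andP[/negPf].
case: i j => [[|[|[|[|//]]]] i4] [[|[|[|[|//]]]] j4];
  rewrite (bool_irrelevance i4 isT) (bool_irrelevance j4 isT) ?a01 ?a21 ?a23 ?a03 //;
  by [rewrite back | rewrite far].
Qed.

(** Only the alternating orientation in which 1 and 3 are the sources is a
    rotation of K22 and not K22 itself, whence the successor map in one case. *)
Lemma C4_orientations : orientation_of C4 F ->
  [\/ has_directed_C4, has_two_paths, has_shortcut | digraph_iso F K22].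
Proof.
move=> [f [f_bij edge anti]].
have f_adj i j : C4 i j -> adj (f i) (f j) || adj (f j) (f i) by rewrite edge.
have f_uniq i j k l : uniq [:: i; j; k; l] -> uniq [:: f i; f j; f k; f l].
  exact: uniq_inj4 (bij_inj f_bij).
have directed i j k l : uniq [:: i; j; k; l] ->
    [&& adj (f i) (f j), adj (f j) (f k), adj (f k) (f l) & adj (f l) (f i)] ->
    has_directed_C4.
  by exists (f i), (f j), (f k), (f l); split=> //; apply: f_uniq.
have two_paths i j k l : uniq [:: i; j; k; l] ->
    [&& adj (f i) (f j), adj (f i) (f l), adj (f j) (f k) & adj (f l) (f k)] ->
    has_two_paths.
  by exists (f i), (f j), (f k), (f l); split=> //; apply: f_uniq.
have shortcut i j k l : uniq [:: i; j; k; l] ->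
    [&& adj (f i) (f j), adj (f i) (f l), adj (f j) (f k) & adj (f k) (f l)] ->
    has_shortcut.
  by exists (f i), (f j), (f k), (f l); split=> //; apply: f_uniq.
have K22_at (g : 'I_4 -> 'I_4) : bijective g -> (forall i j, C4 (g i) (g j) = C4 i j) ->
    [&& adj (f (g 'o_0)) (f (g 'o_1)), adj (f (g 'o_2)) (f (g 'o_1)),
        adj (f (g 'o_2)) (f (g 'o_3)) & adj (f (g 'o_0)) (f (g 'o_3))] ->
    digraph_iso F K22.
  move=> g_bij gC4; apply: (@K22_iso (f \o g)) => [|i j|i j] /=.
  - exact: bij_comp.
  - by rewrite -edge gC4.
  - exact: anti.
have ordS_C4 (i j : 'I_4) : C4 (ordS i) (ordS j) = C4 i j.
  by case: i j => [[|[|[|[|//]]]] i4] [[|[|[|[|//]]]] j4].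
have ordS0 : ordS 'o_0 = 'o_1 by apply: val_inj.
have ordS1 : ordS 'o_1 = 'o_2 by apply: val_inj.
have ordS2 : ordS 'o_2 = 'o_3 by apply: val_inj.
have ordS3 : ordS 'o_3 = 'o_0 by apply: val_inj.
case/orP: (f_adj 'o_0 'o_1 isT) => e0; case/orP: (f_adj 'o_1 'o_2 isT) => e1;
case/orP: (f_adj 'o_2 'o_3 isT) => e2; case/orP: (f_adj 'o_3 'o_0 isT) => e3.
- by constructor 1; apply: (directed 'o_0 'o_1 'o_2 'o_3 isT); rewrite e0 e1 e2 e3.
- by constructor 3; apply: (shortcut 'o_0 'o_1 'o_2 'o_3 isT); rewrite e0 e1 e2 e3.
- by constructor 3; apply: (shortcut 'o_3 'o_0 'o_1 'o_2 isT); rewrite e0 e1 e2 e3.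
- by constructor 2; apply: (two_paths 'o_0 'o_1 'o_2 'o_3 isT); rewrite e0 e1 e2 e3.
- by constructor 3; apply: (shortcut 'o_2 'o_3 'o_0 'o_1 isT); rewrite e0 e1 e2 e3.
- by constructor 4; apply: (K22_at id); [exists id | | rewrite e0 e1 e2 e3].
- by constructor 2; apply: (two_paths 'o_3 'o_0 'o_1 'o_2 isT); rewrite e0 e1 e2 e3.
- by constructor 3; apply: (shortcut 'o_0 'o_3 'o_2 'o_1 isT); rewrite e0 e1 e2 e3.
- by constructor 3; apply: (shortcut 'o_1 'o_2 'o_3 'o_0 isT); rewrite e0 e1 e2 e3.
- by constructor 2; apply: (two_paths 'o_1 'o_0 'o_3 'o_2 isT); rewrite e0 e1 e2 e3.
- constructor 4; apply: (K22_at (@ordS 4)) => //; first exact: ordS_bij.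
  by rewrite ordS0 ordS1 ordS2 ordS3 e0 e1 e2 e3.
- by constructor 3; apply: (shortcut 'o_1 'o_0 'o_3 'o_2 isT); rewrite e0 e1 e2 e3.
- by constructor 2; apply: (two_paths 'o_2 'o_1 'o_0 'o_3 isT); rewrite e0 e1 e2 e3.
- by constructor 3; apply: (shortcut 'o_2 'o_1 'o_0 'o_3 isT); rewrite e0 e1 e2 e3.
- by constructor 3; apply: (shortcut 'o_3 'o_2 'o_1 'o_0 isT); rewrite e0 e1 e2 e3.
- by constructor 1; apply: (directed 'o_0 'o_3 'o_2 'o_1 isT); rewrite e0 e1 e2 e3.
Qed.

End Orientations.

Theorem corollary1p5 (F : digraph) (hF : orientation_of C4 F) :
  eulerian_avoidable F <-> ~ digraph_iso F K22.
Proof.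
split; first by move=> avoid /K22_not_avoidable.
have [[a [b [c [d [abcd arcs]]]]]|[a [b [c [d [abcd arcs]]]]]|[a [b [c [d [abcd arcs]]]]]|//] :=
  C4_orientations hF => _.
- exact: directed_C4_avoidable abcd arcs.
- exact: two_paths_avoidable abcd arcs.
- exact: shortcut_avoidable abcd arcs.
Qed.
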